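(* Assume that $H$ is coercive, i.e. $\lim_{|p|\to\infty}\min_{x\in\mathbb T^n}H_i(x,p)=\infty$ for every $i\in\mathbb I$; that $B(x)$ is a monotone matrix for every $x\in\mathbb T^n$; and that the system $Bu+H[u]=0$ in $\mathbb T^n$ has a solution $v_0\in\operatorname{Lip}(\mathbb T^n)^m$. Assume moreover that $\rho_i:=\sum_{j\in\mathbb I}b_{ij}=0$ on $\mathbb T^n$ for every $i\in\mathbb I$. Then there exists $\mu^0=(\mu^0_i)_{i\in\mathbb I}\in\mathbb P(0)$ such that $$0=\langle\mu^0,L\rangle=\min_{\mu\in\mathbb P(0)}\langle\mu,L\rangle.$$
   Context: Let $m,n\in\mathbb N$, $\mathbb I=\{1,\dots,m\}$, let $\mathbb T^n$ be the $n$-dimensional flat torus, $\Xi$ a (nonempty) compact metric space, $g=(g_i)_{i\in\mathbb I}\in C(\mathbb T^n\times\Xi,\mathbb R^n)^m$ and $L=(L_i)_{i\in\mathbb I}\in C(\mathbb T^n\times\Xi)^m$. For $\phi=(\phi_i)_{i\in\mathbb I}\in C(\mathbb T^n\times\Xi)^m$ set $H_\phi=(H_{\phi,i})_{i\in\mathbb I}$, $H_{\phi,i}(x,p)=\max_{\xi\in\Xi}[-g_i(x,\xi)\cdot p-\phi_i(x,\xi)]$ for $(x,p)\in\mathbb T^n\times\mathbb R^n$, and $H=H_L$. Let $B=(b_{ij})_{i,j\in\mathbb I}\in C(\mathbb T^n)^{m\times m}$, acting by $(Bu)_i(x)=\sum_{j\in\mathbb I}b_{ij}(x)u_j(x)$.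 $F[u]$ stands for $(F_i(x,Du_i(x)))_{i\in\mathbb I}$. Monotone matrix: a real $m\times m$ matrix $A$ is monotone if whenever $u\in\mathbb R^m$ and $u_k=\max_{i\in\mathbb I}u_i\ge0$, then $(Au)_k\ge0$. Viscosity sense: $u\in C(\mathbb T^n)^m$ is a subsolution (resp. supersolution) of $Bu+F[u]=0$ in $\mathbb T^n$ if for every $i\in\mathbb I$, $\psi\in C^1(\mathbb T^n)$ and every maximum (resp. minimum) point $x$ of $u_i-\psi$, one has $(Bu)_i(x)+F_i(x,D\psi(x))\le0$ (resp. $\ge0$); a solution is both. $\operatorname{Lip}(\mathbb T^n)$ is the set of Lipschitz continuous real functions on $\mathbb T^n$. For a collection $\mu=(\mu_i)_{i\in\mathbb I}$ of nonnegative (finite) Borel measures on $\mathbb T^n\times\Xi$ (equivalently, a nonnegative Borel measure on $\mathbb T^n\times\Xi\times\mathbb I$) and $\phi\in C(\mathbb T^n\times\Xi)^m$, $\langle\mu,\phi\rangle=\sum_{i\in\mathbb I}\int_{\mathbb T^n\times\Xi}\phi_i(x,\xi)\,\mu_i(dx,d\xi)$. $\mathcal F(0)$ is the set of all $(\phi,u)\in C(\mathbb T^n\times\Xi)^m\times C(\mathbb T^n)^m$ such that $u$ is a subsolution of $Bu+H_\phi[u]=0$ in $\mathbb T^n$. $\mathbb P$ is the set of Borel probability measures on $\mathbb T^n\times\Xi\times\mathbb I$ (viewed as collections $\mu=(\mu_i)_{i\in\mathbb I}$), and $$\mathbb P(0)=\{\mu\in\mathbb P : \langle\mu,\phi\rangle\ge0\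 \text{for all }(\phi,u)\in\mathcal F(0)\}.$$ *)

(* Defs.v *)
From HB Require Import structures.
From mathcomp Require Import all_boot all_order all_algebra.
From mathcomp Require Import all_classical all_reals all_analysis.

Set Implicit Arguments.
Unset Strict Implicit.
Unset Printing Implicit Defensive.

Import Order.TTheory GRing.Theory Num.Theory.
Import numFieldNormedType.Exports.

Local Open Scope classical_set_scope.
Local Open Scope ring_scope.
Local Open Scope quotient_scope.

(* Nonempty metric spaces; the library's measurable types are pointed, so
   nonemptiness is carried by a (mathematically irrelevant) base point. *)
#[short(type="pmetricType")]
HB.structure Definition PointedMetric (K : numDomainType) :=
  { M of Metric K M & Pointed M }.

Section EuclideanSpace.
Context {R : realType} {n : nat}.

Definition dotv (a b : 'rV[R]_n) : R := \sum_k a 0 k * b 0 k.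

(* The library norm `|a| on 'rV_n is the sup norm. *)
Definition enorm (a : 'rV[R]_n) : R := Num.sqrt (dotv a a).

(* The filter of the limits |p| -> oo. *)
Definition enorm_infty : set_system 'rV[R]_n :=
  filter_from [set: R] (fun r => [set p | r < enorm p]).

Definition grad (f : 'rV[R]_n -> R) (a : 'rV[R]_n) : 'rV[R]_n :=
  \row_k 'D_(delta_mx 0 k) (f : 'rV[R]_n -> R^o) a.

End EuclideanSpace.

Section Torus.
Context (R : realType) (n : nat).

Definition torus_rel (a b : 'rV[R]_n) : bool :=
  [forall k, (a 0 k - b 0 k) \is a Num.int].

Lemma torus_rel_refl : reflexive torus_rel.
Proof. by move=> a; apply/forallP => k; rewrite subrr rpred0. Qed.

Lemma torus_rel_sym : symmetric torus_rel.
Proof.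
by move=> a b; apply/forallP/forallP => ab k; rewrite -opprB rpredN.
Qed.

Lemma torus_rel_trans : transitive torus_rel.
Proof.
move=> b a c /forallP ab /forallP bc; apply/forallP => k.
by rewrite -(subrKA (b 0 k)) rpredD.
Qed.

Canonical torus_equiv :=
  EquivRel torus_rel torus_rel_refl torus_rel_sym torus_rel_trans.

(* The n-torus R^n / Z^n, with the quotient topology. *)
Definition torus := {eq_quot torus_equiv}.

HB.instance Definition _ := Topological.copy torus (quotient_topology torus).
HB.instance Definition _ := Quotient.on torus.
HB.instance Definition _ := isPointed.Build torus (\pi_torus 0).

End Torus.

Section TorusFunctions.
Context {R : realType} {n : nat}.
Local Notation T := (torus R n).

Definition lift_torus (f : T -> R) (a : 'rV[R]_n) : R := f (\pi_T a).

(* The flat distance. *)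
Definition torus_dist (x y : T) : R :=
  inf [set d | exists a b : 'rV[R]_n,
    [/\ \pi_T a = x, \pi_T b = y & d = enorm (a - b)]].

Definition torus_lipschitz (f : T -> R) : Prop :=
  exists K : R, forall x y, `|f x - f y| <= K * torus_dist x y.

Definition torus_C1 (f : T -> R) : Prop :=
  (forall a, differentiable (lift_torus f : 'rV[R]_n -> R^o) a) /\
  continuous (grad (lift_torus f)).

(* The lift is Z^n-periodic, so the chosen representative is immaterial. *)
Definition torus_grad (f : T -> R) (x : T) : 'rV[R]_n :=
  grad (lift_torus f) (repr x).

End TorusFunctions.

Definition monotone_mx (R : realType) (m : nat) (A : 'M[R]_m) : Prop :=
  forall (u : 'cV[R]_m) (k : 'I_m),
    (forall i, u i 0 <= u k 0) -> 0 <= u k 0 -> 0 <= (A *m u) k 0.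

Section System.
Context {R : realType} {m n : nat}.
Local Notation T := (torus R n).

Definition coupling (B : T -> 'M[R]_m) (u : 'I_m -> T -> R)
    (i : 'I_m) (x : T) : R :=
  \sum_j B x i j * u j x.

Definition subsolution (B : T -> 'M[R]_m) (F : 'I_m -> T -> 'rV[R]_n -> R)
    (u : 'I_m -> T -> R) : Prop :=
  (forall i, continuous (u i)) /\
  forall (i : 'I_m) (psi : T -> R) (x : T), torus_C1 psi ->
    (forall y, u i y - psi y <= u i x - psi x) ->
    coupling B u i x + F i x (torus_grad psi x) <= 0.

Definition supersolution (B : T -> 'M[R]_m) (F : 'I_m -> T -> 'rV[R]_n -> R)
    (u : 'I_m -> T -> R) : Prop :=
  (forall i, continuous (u i)) /\
  forall (i : 'I_m) (psi : T -> R) (x : T), torus_C1 psi ->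
    (forall y, u i x - psi x <= u i y - psi y) ->
    0 <= coupling B u i x + F i x (torus_grad psi x).

Definition solution (B : T -> 'M[R]_m) (F : 'I_m -> T -> 'rV[R]_n -> R)
    (u : 'I_m -> T -> R) : Prop :=
  subsolution B F u /\ supersolution B F u.

(* The infimum is a minimum when F i is continuous, as the torus is compact. *)
Definition coercive (F : 'I_m -> T -> 'rV[R]_n -> R) : Prop :=
  forall i, inf (range (fun x => F i x p)) @[p --> enorm_infty] --> +oo.

End System.

Section Control.
Context {R : realType} {m n : nat} {Xi : pmetricType R}.
Local Notation T := (torus R n).

(* The supremum is a maximum when g and phi are continuous and Xi is compact. *)
Definition hamiltonian (g : 'I_m -> T * Xi -> 'rV[R]_n)
    (phi : 'I_m -> T * Xi -> R) (i : 'I_m) (x : T) (p : 'rV[R]_n) : R :=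
  sup (range (fun xi => - dotv (g i (x, xi)) p - phi i (x, xi))).

Definition F0 (g : 'I_m -> T * Xi -> 'rV[R]_n) (B : T -> 'M[R]_m) :
    set (('I_m -> T * Xi -> R) * ('I_m -> T -> R)) :=
  [set phiu | (forall i, continuous (phiu.1 i)) /\
              subsolution B (hamiltonian g phiu.1) phiu.2].

Definition measures : Type :=
  'I_m -> {measure set (g_sigma_algebraType (@open (T * Xi)%type)) -> \bar R}.

Definition pairing (mu : measures) (phi : 'I_m -> T * Xi -> R) : R :=
  \sum_i \int[mu i]_(z in setT) phi i z.

(* A Borel probability measure on T * Xi * 'I_m is identified with the family
   of its slices A |-> mu (A * {i}), whose total masses add up to 1. *)
Definition prob_measures : set measures :=
  [set mu : measures | (\sum_i mu i setT = 1)%E].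

Definition P0 (g : 'I_m -> T * Xi -> 'rV[R]_n) (B : T -> 'M[R]_m) :
    set measures :=
  [set mu : measures | prob_measures mu /\
            forall phi u, F0 g B (phi, u) -> 0 <= pairing mu phi].

End Control.

Arguments measures : clear implicits.

(* Main.v *)
From HB Require Import structures.
Require Import Defs.
From mathcomp Require Import all_boot all_order all_algebra.
From mathcomp Require Import all_classical all_reals all_analysis.
From mathcomp Require Import measurable_realfun.
From mathcomp Require Import ring lra.

Import Order.TTheory GRing.Theory Num.Theory.
Import numFieldNormedType.Exports.

Local Open Scope classical_set_scope.
Local Open Scope ring_scope.

(** Why the theorem holds. Call a pair [(phi, u)] admissible when [u] is a
    subsolution for [phi], that is, when it belongs to [F0 g B]. The measure
    sought is a probability which is nonnegative on the [phi] of admissible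
    pairs and vanishes on [L]. Testing with the admissible pair [(L, v0)] shows
    that [L] has nonnegative integral against every competitor, so such a
    probability is a minimizer.

    It is obtained by separation. The functions [phi - t * L], with [(phi, u)]
    admissible and [t > 0], form a convex cone ([F0_add], [F0_scale]), and none
    of them is bounded above by a negative constant: otherwise, after scaling to
    [t = 1], the equation for [L] would have a strict subsolution, which cannot
    exist next to the solution [v0] ([no_strict_subsolution]). The Hahn-Banach
    theorem therefore gives a positive functional of mass one, defined on all
    bounded functions, which is nonnegative on the cone ([cone_separation]).
    Letting [t] vary forces it to vanish on [L] and to be nonnegative on each
    admissible [phi] ([optimal_functional]); the Riesz-Markov theorem turns it
    into a family of measures ([riesz_slices]).

    Both facts on viscosity solutions come from doubling variables with the
    smooth periodic penalty [sum_k sin^2 (pi (x_k - y_k))] ([doubling]). The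
    gradients which appear are test gradients of subsolutions, and coercivity
    bounds those ([F0_gradient_bound]). In the comparison, the condition that
    the rows of [B] sum to zero lets monotonicity act at the maximum of the
    components of [u - v0] whatever its sign ([coupling_at_max]).

    The Riesz-Markov theorem is proved by coding. A countable family of sets
    cuts the compact space into cells indexed by binary words; the functional
    gives each cell a mass, the cells of a given depth are laid out as
    consecutive intervals of these lengths, and a real number is decoded to the
    point to which its cells shrink. The image of Lebesgue measure under the
    decoding map is the representing measure ([riesz_representation]). *)

Set Implicit Arguments.
Unset Strict Implicit.
Unset Printing Implicit Defensive.

(** * Sublinear functionals and the Hahn-Banach theorem *)

Section HahnBanach.
Context {R : realType} {V : lmodType R}.
Implicit Types (D : set V) (q : V -> R).

Definition linear_subspace D : Prop :=
  [/\ D 0, forall x y, D x -> D y -> D (x + y) &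
      forall (t : R) x, D x -> D (t *: x)].

(** The scaling inequality for [t] and for its inverse together give equality,
    so the weaker condition is the one to verify. *)
Definition sublinear_on D q : Prop :=
  (forall x y, D x -> D y -> q (x + y) <= q x + q y) /\
  (forall (t : R) x, 0 < t -> D x -> q (t *: x) <= t * q x).

Definition linear_on D q : Prop :=
  (forall x y, D x -> D y -> q (x + y) = q x + q y) /\
  (forall (t : R) x, D x -> q (t *: x) = t * q x).

Lemma inf_le_approx (S : set R) (c : R) : has_lbound S ->
  (forall e, 0 < e -> exists2 s, S s & s <= c + e) -> inf S <= c.
Proof.
move=> lbS Sc; apply/ler_addgt0Pr => e /Sc[s Ss sce].
exact: le_trans (ge_inf lbS Ss) sce.
Qed.

Lemma sublinear_scale D q t x : linear_subspace D -> sublinear_on D q ->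
  0 < t -> D x -> q (t *: x) = t * q x.
Proof.
move=> [_ _ DZ] [_ qZ] t0 Dx; apply/eqP; rewrite eq_le qZ//=.
have := qZ t^-1 (t *: x); rewrite invr_gt0 => /(_ t0 (DZ _ _ Dx)).
by rewrite scalerA mulVf ?gt_eqF// scale1r mulrC ler_pdivlMr// mulrC.
Qed.

Lemma sublinear0 D q : linear_subspace D -> sublinear_on D q -> q 0 = 0.
Proof.
move=> sD qs; have [D0 _ _] := sD.
by have := @sublinear_scale D q 2 0 sD qs (ltr0Sn _ 1) D0; rewrite scaler0; lra.
Qed.

Lemma linear_subspaceN D x : linear_subspace D -> D x -> D (- x).
Proof. by move=> [_ _ DZ] Dx; rewrite -scaleN1r; exact: DZ. Qed.

(** Keeps the infima taken over chains and along directions finite. *)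
Lemma sublinear_lower D q x y : linear_subspace D -> sublinear_on D q ->
  D x -> D y -> q y <= q (x + y) + q (- x).
Proof.
move=> sD qs Dx Dy; have [D0 DA _] := sD; have [qD _] := qs.
have := qD (x + y) (- x) (DA _ _ Dx Dy) (linear_subspaceN sD Dx).
by rewrite addrAC subrr add0r.
Qed.

(** The infimum of a chain of sublinear functionals is sublinear, since two
    members of a chain can be replaced by the smaller of them. *)
Lemma sublinear_inf_chain D (A : set (V -> R)) (q0 : V -> R) (p : V -> R) :
  linear_subspace D -> A q0 ->
  (forall q, A q -> sublinear_on D q /\ forall x, D x -> q x <= p x) ->
  (forall q q', A q -> A q' ->
     (forall x, D x -> q x <= q' x) \/ (forall x, D x -> q' x <= q x)) ->
  let Q x := inf [set q x | q in A] in
  [/\ sublinear_on D Q & forall q x, A q -> D x -> Q x <= q x].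
Proof.
move=> sD Aq0 As Atot Q; have [D0 DA DZ] := sD.
have lbA x : D x -> has_lbound [set q x | q in A].
  move=> Dx; exists (- p (- x)) => _ [q Aq <-].
  have [qs qp] := As _ Aq.
  have := @sublinear_lower D q x 0 sD qs Dx D0.
  rewrite addr0 (sublinear0 sD qs) => h.
  by have := qp _ (linear_subspaceN sD Dx); lra.
have hiA x : D x -> has_inf [set q x | q in A].
  by move=> Dx; split; [exists (q0 x), q0|exact: lbA].
have Qle q x : A q -> D x -> Q x <= q x.
  by move=> Aq Dx; apply: ge_inf; [exact: lbA|exists q].
split=> //; split.
- move=> x y Dx Dy; apply/ler_addgt0Pr => e e0.
  have e20 : 0 < e / 2 by rewrite divr_gt0.
  have [_ [q1 Aq1 <-] q1x] := inf_adherent e20 (hiA _ Dx).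
  have [_ [q2 Aq2 <-] q2y] := inf_adherent e20 (hiA _ Dy).
  rewrite -/(Q x) in q1x; rewrite -/(Q y) in q2y.
  have [[q1D _] _] := As _ Aq1; have [[q2D _] _] := As _ Aq2.
  have DAxy := DA _ _ Dx Dy.
  have [h|h] := Atot _ _ Aq1 Aq2.
    have := Qle _ _ Aq1 DAxy; have := q1D _ _ Dx Dy; have := h _ Dy.
    by lra.
  have := Qle _ _ Aq2 DAxy; have := q2D _ _ Dx Dy; have := h _ Dx.
  by lra.
- move=> t x t0 Dx; apply: inf_le_approx; first exact/lbA/DZ.
  move=> e e0; have et0 : 0 < e / t by rewrite divr_gt0.
  have [_ [q Aq <-] qx] := inf_adherent et0 (hiA _ Dx).
  exists (q (t *: x)); first by exists q.
  have [[_ qZ] _] := As _ Aq.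
  apply: le_trans (qZ _ _ t0 Dx) _; rewrite -/(Q x) in qx *.
  have -> : t * Q x + e = t * (Q x + e / t).
    by rewrite mulrDr mulrCA divff ?mulr1 ?gt_eqF.
  by rewrite ler_pM2l// ltW.
Qed.

(** Replacing [q x] by the infimum of [q (x + t *: y) - t * q y] over [t >= 0]
    keeps sublinearity and can only decrease [q]. A minimal [q] is unchanged by
    it and hence satisfies [q x + q y <= q (x + y)]. *)
Lemma sublinear_push D q y : linear_subspace D -> sublinear_on D q -> D y ->
  exists q', [/\ sublinear_on D q', forall x, D x -> q' x <= q x &
                 forall x, D x -> q' x <= q (x + y) - q y].
Proof.
move=> sD qs Dy; have [D0 DA DZ] := sD; have [qD qZ] := qs.
pose S x := [set q (x + t *: y) - t * q y | t in [set t : R | 0 <= t]].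
have lbS x : D x -> has_lbound (S x).
  move=> Dx; exists (- q (- x)) => _ [t /= t0 <-].
  have := @sublinear_lower D q x (t *: y) sD qs Dx (DZ _ _ Dy).
  move: t0; rewrite [0 <= t]le_eqVlt => /orP[/eqP<-|t0].
    by rewrite scale0r (sublinear0 sD qs) mul0r; lra.
  by rewrite (sublinear_scale sD qs t0 Dy); lra.
have memS x t : 0 <= t -> S x (q (x + t *: y) - t * q y) by move=> t0; exists t.
have hiS x : D x -> has_inf (S x).
  by move=> Dx; split; [exists (q (x + 0 *: y) - 0 * q y); exact: memS|exact: lbS].
exists (fun x => inf (S x)); split.
- split.
  + move=> x1 x2 Dx1 Dx2; apply/ler_addgt0Pr => e e0.
    have e20 : 0 < e / 2 by rewrite divr_gt0.
    have [_ [t1 /= t10 <-] h1] := inf_adherent e20 (hiS _ Dx1).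
    have [_ [t2 /= t20 <-] h2] := inf_adherent e20 (hiS _ Dx2).
    have := ge_inf (lbS _ (DA _ _ Dx1 Dx2)) (memS (x1 + x2) (t1 + t2) (addr_ge0 t10 t20)).
    rewrite scalerDl addrACA.
    have := qD (x1 + t1 *: y) (x2 + t2 *: y).
    move=> /(_ (DA _ _ Dx1 (DZ _ _ Dy)) (DA _ _ Dx2 (DZ _ _ Dy))).
    by move: h1 h2; lra.
  + move=> t x t0 Dx; apply: inf_le_approx; first exact/lbS/DZ.
    move=> e e0; have et0 : 0 < e / t by rewrite divr_gt0.
    have [_ [s /= s0 <-] hs] := inf_adherent et0 (hiS _ Dx).
    exists (q (t *: x + (t * s) *: y) - (t * s) * q y).
      by apply: memS; rewrite mulr_ge0// ltW.
    rewrite -scalerA -scalerDr (sublinear_scale sD qs t0 (DA _ _ Dx (DZ _ _ Dy))).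
    have -> : t * inf (S x) + e = t * (inf (S x) + e / t).
      by rewrite mulrDr mulrCA divff ?mulr1 ?gt_eqF.
    by rewrite -mulrA -mulrBr ler_pM2l// ltW.
- move=> x Dx; have := ge_inf (lbS _ Dx) (memS x 0 (lexx 0)).
  by rewrite scale0r addr0 mul0r subr0.
- move=> x Dx; have := ge_inf (lbS _ Dx) (memS x 1 ler01).
  by rewrite scale1r mul1r.
Qed.

(** Zorn's lemma yields a sublinear functional minimal among those below [p];
    minimality makes it linear. *)
Theorem hahn_banach D (p : V -> R) : linear_subspace D -> sublinear_on D p ->
  exists2 l : V -> R, linear_on D l & forall x, D x -> l x <= p x.
Proof.
move=> sD ps; have [D0 DA DZ] := sD.
pose P (q : V -> R) := sublinear_on D q /\ forall x, D x -> q x <= p x.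
pose T := {q : V -> R | P q}.
pose below (a b : T) := `[< forall x, D x -> sval b x <= sval a x >].
have p_ok : P p by [].
have [|||[q [qs qp]] qmin] := @ZL_preorder T (exist P p p_ok) below.
- by move=> a; apply/asboolP.
- move=> b a c /asboolP ab /asboolP bc; apply/asboolP => x Dx.
  exact: le_trans (bc _ Dx) (ab _ Dx).
- move=> A Atot; have [[a0 Aa0]|/set0P/negP/negPn/eqP A0] := pselect (A !=set0);
    last by exists (exist P p p_ok) => s; rewrite A0.
  pose A' := [set sval a | a in A].
  have [|||Qs Qle] := @sublinear_inf_chain D A' (sval a0) p sD.
  + by exists a0.
  + by move=> _ [a Aa <-]; exact: svalP a.
  + move=> _ _ [a Aa <-] [b Ab <-].
    by have [/asboolP|/asboolP] := Atot _ _ Aa Ab; [right|left].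
  have Q_ok : P (fun x => inf [set q x | q in A']).
    split=> // x Dx; apply: le_trans (Qle (sval a0) x _ Dx) _; first by exists a0.
    by have [_] := svalP a0; apply.
  exists (exist P _ Q_ok) => s As; apply/asboolP => x Dx /=.
  by apply: Qle => //; exists s.
exists q => //.
have qA x y : D x -> D y -> q (x + y) = q x + q y.
  move=> Dx Dy; apply/eqP; rewrite eq_le; have [-> // _] := qs; rewrite andTb.
  have [q' [q's q'q q'y]] := sublinear_push sD qs Dy.
  have q'_ok : P q'.
    by split=> // z Dz; exact: le_trans (q'q _ Dz) (qp _ Dz).
  have /asboolP/= qq' := qmin (exist P q' q'_ok) (introT (asboolP _) q'q).
  by have := qq' _ Dx; have := q'y _ Dx; lra.
have qN x : D x -> q (- x) = - q x.
  move=> Dx; have := qA _ _ Dx (linear_subspaceN sD Dx).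
  by rewrite subrr (sublinear0 sD qs); lra.
split=> // t x Dx; have [t0|t0|->] := ltgtP t 0.
- have Nt0 : 0 < - t by rewrite oppr_gt0.
  have -> : t *: x = - (- t *: x) by rewrite scaleNr opprK.
  rewrite qN; last exact: DZ.
  by rewrite (sublinear_scale sD qs Nt0 Dx) mulNr opprK.
- exact: (sublinear_scale sD qs t0 Dx).
- by rewrite scale0r mul0r (sublinear0 sD qs).
Qed.

End HahnBanach.

(** * Separating a convex cone from the negative functions *)

Section Separation.
Context {R : realType} {Z : Type}.
Implicit Types (f : Z -> R) (G : set (Z -> R)).

Definition bounded_on_type : set (Z -> R) :=
  [set f | exists M, forall z, `|f z| <= M].

(** The domain is the space of all bounded functions: it contains the
    indicators of arbitrary sets, whose values serve as masses. *)
Definition positive_functional (l : (Z -> R) -> R) : Prop :=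
  [/\ forall f g, bounded_on_type f -> bounded_on_type g ->
        l (fun z => f z + g z) = l f + l g,
      forall (t : R) f, bounded_on_type f -> l (fun z => t * f z) = t * l f &
      forall f, bounded_on_type f -> (forall z, 0 <= f z) -> 0 <= l f].

Lemma bounded_on_add f g : bounded_on_type f -> bounded_on_type g ->
  bounded_on_type (fun z => f z + g z).
Proof.
move=> [M fM] [N gN]; exists (M + N) => z.
exact: le_trans (ler_normD _ _) (lerD (fM z) (gN z)).
Qed.

Lemma bounded_on_scale (t : R) f : bounded_on_type f ->
  bounded_on_type (fun z => t * f z).
Proof.
by move=> [M fM]; exists (`|t| * M) => z; rewrite normrM ler_wpM2l.
Qed.

Lemma bounded_on_mul f g : bounded_on_type f -> bounded_on_type g ->
  bounded_on_type (fun z => f z * g z).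
Proof.
by move=> [M fM] [N gN]; exists (M * N) => z; rewrite normrM ler_pM.
Qed.

Lemma bounded_on_cst (c : R) : bounded_on_type (fun=> c).
Proof. by exists `|c|. Qed.

Lemma functional0 l : positive_functional l -> l (fun=> 0) = 0.
Proof.
move=> [_ lZ _]; transitivity (l (fun z => 0 * (fun=> 0) z)).
  by congr l; apply/funext => z; rewrite mul0r.
by rewrite lZ ?mul0r//; exact: bounded_on_cst.
Qed.

Lemma functional_sub l f g : positive_functional l ->
  bounded_on_type f -> bounded_on_type g ->
  l (fun z => f z - g z) = l f - l g.
Proof.
move=> [lD lZ _] bf bg; have bN := bounded_on_scale (-1) bg.
transitivity (l (fun z => f z + (-1) * g z)).
  by congr l; apply/funext => z; rewrite mulN1r.
by rewrite (lD _ _ bf bN) lZ// mulN1r.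
Qed.

Lemma functional_sum l (I : Type) (s : seq I) (F : I -> Z -> R) :
  positive_functional l -> (forall i, bounded_on_type (F i)) ->
  bounded_on_type (fun z => \sum_(i <- s) F i z) /\
  l (fun z => \sum_(i <- s) F i z) = \sum_(i <- s) l (F i).
Proof.
move=> lpos bF; have [lD _ _] := lpos; elim: s => [|i s [bs IH]].
  under eq_fun do rewrite big_nil; split; first exact: bounded_on_cst.
  by rewrite big_nil functional0.
under eq_fun do rewrite big_cons.
by rewrite big_cons lD// IH; split=> //; exact: bounded_on_add.
Qed.

Lemma functional_le l f g : positive_functional l ->
  bounded_on_type f -> bounded_on_type g ->
  (forall z, f z <= g z) -> l f <= l g.
Proof.
move=> lpos bf bg fg; rewrite -subr_ge0 -(functional_sub lpos)//.
have [_ _ l0] := lpos; apply: l0 => [|z]; last by rewrite subr_ge0.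
have -> : (fun z => g z - f z) = (fun z => g z + (-1) * f z).
  by apply/funext => z; rewrite mulN1r.
exact/bounded_on_add/bounded_on_scale.
Qed.

(** The gauge [f |-> inf {c | f + h <= c for some h in G}] is sublinear and at
    most [sup f], so a linear functional below it is positive of mass one; it is
    also nonpositive on [- G]. The gauge is finite because no member of [G] is
    bounded above by a negative constant. *)
Lemma cone_separation G :
  G `<=` bounded_on_type -> G (fun=> 0) ->
  (forall f g, G f -> G g -> G (fun z => f z + g z)) ->
  (forall (t : R) f, 0 < t -> G f -> G (fun z => t * f z)) ->
  (forall f e, G f -> 0 < e -> ~ forall z, f z <= - e) ->
  exists l, [/\ positive_functional l, l (fun=> 1) = 1 &
                forall f, G f -> 0 <= l f].
Proof.
move=> Gb G0 GD GZ Gneg.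
pose V : lmodType R := Z -> R^o.
pose S f := [set c : R | exists2 h, G h & forall z, f z + h z <= c].
pose p (f : V) : R := inf (S f).
have lbS f : bounded_on_type f -> has_lbound (S f).
  move=> [M fM]; exists (- M) => c [h Gh fh]; rewrite leNgt; apply/negP => cM.
  apply: (Gneg h (- (c + M)) Gh); first by lra.
  move=> z; have := fh z; have := fM z; rewrite ler_norml => /andP[]; lra.
have hiS f : bounded_on_type f -> has_inf (S f).
  move=> bf; split; last exact: lbS.
  have [M fM] := bf; exists M; exists (fun=> 0) => // z.
  by rewrite addr0 (le_trans (ler_norm _)).
have sD : linear_subspace (bounded_on_type : set V).
  split; [exact: bounded_on_cst|exact: bounded_on_add|].
  by move=> t f bf; exact: bounded_on_scale.
have ps : sublinear_on (bounded_on_type : set V) p.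
  split.
  - move=> f g bf bg; apply/ler_addgt0Pr => e e0.
    have e20 : 0 < e / 2 by rewrite divr_gt0.
    have [c [h Gh fh] cp] := inf_adherent e20 (hiS _ bf).
    have [c' [h' Gh' gh'] cp'] := inf_adherent e20 (hiS _ bg).
    have : p (f + g) <= c + c'.
      apply: ge_inf; first exact/lbS/bounded_on_add.
      exists (fun z => h z + h' z); first exact: GD.
      by move=> z; have := fh z; have := gh' z; rewrite fctE; lra.
    by move: cp cp'; rewrite -/(p f) -/(p g); lra.
  - move=> t f t0 bf; apply: inf_le_approx; first exact/lbS/bounded_on_scale.
    move=> e e0; have et0 : 0 < e / t by rewrite divr_gt0.
    have [c [h Gh fh] cp] := inf_adherent et0 (hiS _ bf).
    exists (t * c).
      exists (fun z => t * h z); first exact: GZ.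
      by move=> z; rewrite -mulrDr ler_pM2l//; exact: fh.
    have -> : t * p f + e = t * (p f + e / t).
      by rewrite mulrDr mulrCA divff ?mulr1 ?gt_eqF.
    by rewrite ler_pM2l// ltW.
have [l [lD lZ] lp] := hahn_banach sD ps.
have pc f h c : bounded_on_type f -> G h -> (forall z, f z + h z <= c) -> l f <= c.
  move=> bf Gh fhc; apply: le_trans (lp _ bf) _.
  by apply: ge_inf; [exact: lbS|exists h].
have lN f : bounded_on_type f -> l (fun z => - f z) = - l f.
  move=> bf; rewrite -mulN1r -lZ//; congr l.
  by apply/funext => z; rewrite -[RHS]/(-1 * f z) mulN1r.
have bN f : bounded_on_type f -> bounded_on_type (fun z => - f z).
  by move=> [M fM]; exists M => z; rewrite normrN.
exists l; split.
- split=> // f bf f0; rewrite -oppr_le0 -lN//.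
  by apply: (pc _ _ _ (bN _ bf) G0) => z; rewrite addr0 oppr_le0.
- apply/eqP; rewrite eq_le (pc _ _ _ (bounded_on_cst 1) G0) => [|z]; last by rewrite addr0.
  rewrite andTb -lerN2 -(lN _ (bounded_on_cst 1)).
  by apply: (pc _ _ _ (bN _ (bounded_on_cst 1)) G0) => z; rewrite addr0.
- move=> f Gf; rewrite -oppr_le0 -(lN _ (Gb _ Gf)).
  by apply: (pc _ _ _ (bN _ (Gb _ Gf)) Gf) => z; rewrite addNr.
Qed.

End Separation.

(** * Riesz-Markov representation *)

(** Second countability and regularity in one condition. Its use is that the
    bits telling which sets [C j] contain a point determine the point, and that
    finitely many of these bits locate it up to a given neighbourhood. *)
Definition regular_family (X : topologicalType) (C : nat -> set X) : Prop :=
  forall (x : X) (U : set X), nbhs x U ->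
    exists j, nbhs x (C j) /\ closure (C j) `<=` U.

Lemma compact_continuous_bounded (R : realType) (X : topologicalType) (f : X -> R) :
  compact [set: X] -> continuous f -> bounded_on_type f.
Proof.
move=> cX cf.
have := continuous_compact (@continuous_subspaceT _ _ [set: X] f cf) cX.
move=> /compact_bounded[M [_ fM]]; exists (M + 1) => x.
by apply: (fM (M + 1)); [rewrite ltrDl|exists x].
Qed.

Section RieszMarkov.
Context {R : realType} {X : ptopologicalType}.
Variables (C : nat -> set X) (l : (X -> R) -> R).
Hypotheses (cX : compact [set: X]) (regC : regular_family C)
  (lpos : positive_functional l).

(** Words carry their latest bit first: the bit put in front of [v] concerns the
    set of index [size v]. *)
Fixpoint cell (w : seq bool) : set X :=
  if w is b :: v then cell v `&` (if b then C (size v) else ~` C (size v))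
  else setT.

Definition cell_mass (w : seq bool) : R := l \1_(cell w).

(** The cells of each depth are laid out on the line in lexicographic order,
    with their masses as lengths; refining a cell subdivides its interval. *)
Fixpoint cell_left (w : seq bool) : R :=
  if w is b :: v then cell_left v + (if b then cell_mass (false :: v) else 0)
  else 0.

Definition cell_itv (w : seq bool) : set R :=
  [set t | cell_left w <= t < cell_left w + cell_mass w].

Fixpoint word (t : R) (k : nat) : seq bool :=
  if k is j.+1 then (cell_left (true :: word t j) <= t) :: word t j else [::].

Lemma size_word t k : size (word t k) = k.
Proof. by elim: k => //= k ->. Qed.

Lemma bounded_on_indic (A : set X) : bounded_on_type (\1_A : X -> R).
Proof. by exists 1 => z; rewrite indicE; case: (_ \in _); rewrite ?normr1 ?normr0. Qed.

Lemma cell_indic v : (\1_(cell v) : X -> R) =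
  (fun z => \1_(cell (false :: v)) z + \1_(cell (true :: v)) z).
Proof.
apply/funext => z /=; rewrite !indicE !in_setI in_setC.
by case: (z \in cell v); case: (z \in C _); rewrite /= ?mulr0n ?(addr0, add0r).
Qed.

Lemma cell_mass_split v :
  cell_mass v = cell_mass (false :: v) + cell_mass (true :: v).
Proof.
have [lD _ _] := lpos.
by rewrite {1}/cell_mass cell_indic lD//; exact: bounded_on_indic.
Qed.

Lemma cell_mass_ge0 w : 0 <= cell_mass w.
Proof.
have [_ _ l0] := lpos; apply: l0; first exact: bounded_on_indic.
by move=> z; rewrite indicE ler0n.
Qed.

Lemma cell_nonempty w : 0 < cell_mass w -> cell w !=set0.
Proof.
move=> w0; apply/set0P/eqP => cw0; move: w0.
by rewrite /cell_mass cw0 indic0 (functional0 lpos) ltxx.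
Qed.

Lemma cell_itv_split v t : cell_itv v t ->
  cell_itv ((cell_left (true :: v) <= t) :: v) t.
Proof.
rewrite /cell_itv/= (cell_mass_split v) => /andP[vt tv].
have [h|h] := leP (cell_left v + cell_mass (false :: v)) t.
  by rewrite h/= -addrA.
by rewrite addr0 vt h.
Qed.

Lemma cell_itv_tail b v t : cell_itv (b :: v) t ->
  cell_itv v t /\ b = (cell_left (true :: v) <= t).
Proof.
rewrite /cell_itv/= (cell_mass_split v).
have := cell_mass_ge0 (false :: v); have := cell_mass_ge0 (true :: v).
have [h|h] := leP (cell_left v + cell_mass (false :: v)) t;
  case: b => m1 m0 /andP[h1 h2]; split=> //; try (apply/andP; split); lra.
Qed.

Lemma word_in t k : cell_itv [::] t -> cell_itv (word t k) t.
Proof. by move=> t0; elim: k => // k IH; exact: cell_itv_split. Qed.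

Lemma word_uniq w t : cell_itv w t -> word t (size w) = w.
Proof. by elim: w => //= b v IH /cell_itv_tail[/IH-> <-]. Qed.

Lemma cell_itv_root w : cell_itv w `<=` cell_itv [::].
Proof. by elim: w => // b v IH t /cell_itv_tail[/IH]. Qed.

Lemma cell_itv_nonempty w t : cell_itv w t -> cell w !=set0.
Proof.
by move=> /andP[a b]; apply: cell_nonempty; move: (le_lt_trans a b); lra.
Qed.

Lemma cell_word_decr t j k : (j <= k)%N -> cell (word t k) `<=` cell (word t j).
Proof.
elim: k => [|k IH]; first by rewrite leqn0 => /eqP->.
rewrite leq_eqVlt => /predU1P[->//|/IH h] x [/h].
by [].
Qed.

Lemma cell_decides w j : (j < size w)%N -> cell w `<=` C j \/ cell w `<=` ~` C j.
Proof.
elim: w => // b v IH /=; rewrite ltnS leq_eqVlt => /predU1P[->|/IH[h|h]].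
- by case: b; [left|right] => x [].
- by left => x [/h].
- by right => x [/h].
Qed.

(** The cells of the code of [t] shrink to a point; outside the interval of the
    total mass there is no code and the default point is used. *)
Definition decode (t : R) : X :=
  if t \in cell_itv [::] then
    xget point (\bigcap_k closure (cell (word t k)))
  else point.

(** Nested nonempty cells accumulate somewhere, by compactness. *)
Lemma decodeP t k : cell_itv [::] t -> closure (cell (word t k)) (decode t).
Proof.
move=> t0; rewrite /decode (mem_set t0).
set K := \bigcap_k _; suff /(xgetPex point)/(_ k Logic.I) : exists x, K x by [].
pose F := filter_from [set: nat] (fun k => cell (word t k)).
have FF : ProperFilter F.
  apply: filter_from_proper; last first.
    by move=> i _; exact: cell_itv_nonempty (word_in i t0).
  apply: filter_from_filter; first by exists 0%N.
  move=> i j _ _; exists (maxn i j) => // x xij.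
  by split; apply: cell_word_decr xij; rewrite ?leq_maxl ?leq_maxr.
have [x [_ xF]] : [set: X] `&` cluster F !=set0.
  by apply: cX; exact: filterT.
exists x => i _; move: xF; rewrite clusterE; apply.
by exists i.
Qed.

(** The bit of index [j] of the code of [t] tells whether the cells shrinking
    to [decode t] lie in [C j]; when [decode t] is interior to [C j] it does. *)
Lemma decode_cell t U : cell_itv [::] t -> nbhs (decode t) U ->
  exists k, closure (cell (word t k)) `<=` U.
Proof.
move=> t0 /regC[j [jt jU]]; exists j.+1.
apply: subset_trans jU; apply: closure_subset.
have [//|h|h] := @cell_decides (word t j.+1) j; first by rewrite size_word.
  exact: h.
by have [x [/h]] := decodeP j.+1 t0 jt.
Qed.

Lemma measurable_cell_itv w : measurable (cell_itv w : set (measurableTypeR R)).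
Proof.
have -> : cell_itv w = `[cell_left w, cell_left w + cell_mass w[%classic.
  by apply/seteqP; split => x /=; rewrite in_itv.
exact: measurable_itv.
Qed.

(** By [decode_cell] the preimage of an open set is, inside the interval of the
    total mass, the union of the intervals of the cells whose closure lies in
    the open set; there are countably many words. *)
Lemma measurable_decode : measurable_fun setT
  (decode : measurableTypeR R -> g_sigma_algebraType (@open X)).
Proof.
apply: measurability => [|_ [U oU <-]]; first by [].
rewrite setTI.
have -> : decode @^-1` U =
    (\bigcup_w (if `[< closure (cell w) `<=` U >] then cell_itv w else set0))
    `|` (~` cell_itv [::] `&` (if `[< U point >] then setT else set0)).
  apply/seteqP; split => t /=.
  - have [t0 Ut|nt0] := pselect (cell_itv [::] t).
      left; have [|k kU] := @decode_cell t U t0; first exact: open_nbhs_nbhs.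
      by exists (word t k) => //; rewrite asboolT//=; exact: (word_in k t0).
    rewrite /decode memNset// => Up; right; split=> //.
    by rewrite asboolT.
  - case=> [[w _]|[nt0]].
      case: asboolP => // wU wt; apply: wU.
      rewrite -(word_uniq wt); apply: decodeP.
      exact: cell_itv_root wt.
    by case: asboolP => // Up _; rewrite /decode (memNset nt0); exact: Up.
apply: measurableU.
  apply: countable_bigcupT_measurable => [|w]; first exact: countableP.
  by case: ifP => _ //; exact: measurable_cell_itv.
apply: measurableI; last by case: ifP.
by apply: measurableC; exact: measurable_cell_itv.
Qed.

(** Finitely many interiors of sets [C j] on whose closures [f] is almost
    constant cover the space, and a nonempty cell of large depth lies in one of
    these sets. *)
Lemma cell_oscillation (f : X -> R) (e : R) : continuous f -> 0 < e ->
  exists k, forall w, size w = k -> forall x y : X,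
    closure (cell w) x -> closure (cell w) y -> `|f x - f y| <= e.
Proof.
move=> cf e0.
pose small j := forall x y, closure (C j) x -> closure (C j) y -> `|f x - f y| <= e.
have : finite_subset_cover [set j | small j] (fun j => (C j)°) [set: X].
  move: cX; rewrite compact_cover; apply=> [j _|x _]; first exact: open_interior.
  have e20 : 0 < e / 2 by rewrite divr_gt0.
  have /regC[j [jx jU]] : nbhs x [set y | `|f x - f y| < e / 2].
    by have /cvgrPdist_lt := cf x; apply.
  exists j => // y z /jU/= xy /jU/= xz.
  have := ler_distD (f x) (f y) (f z).
  by rewrite (distrC (f y) (f x)); move: xy xz; lra.
move=> [D Dsmall cov]; exists (\max_(j <- finmap.enum_fset D) j.+1)%N => w wD x y wx wy.
have [cw0|/set0P[z wz]] := eqVneq (cell w) set0.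
  by move: wx; rewrite cw0 closure0.
have [j jD jz] := cov z Logic.I.
have jw : (j < size w)%N by rewrite wD; exact: (@leq_bigmax_seq nat _ xpredT (fun j => j.+1) j jD).
have [h|h] := cell_decides jw; last by have := h _ wz (interior_subset jz).
have /set_mem sj := Dsmall _ jD.
by apply: sj; [exact: closure_subset h _ wx|exact: closure_subset h _ wy].
Qed.

Definition parameter_measure : {measure set (measurableTypeR R) -> \bar R} :=
  mrestr lebesgue_measure (measurable_cell_itv [::]).

Local Notation nu := parameter_measure.

Lemma parameter_measureE A : nu A = lebesgue_measure (A `&` cell_itv [::]).
Proof. by []. Qed.

Lemma parameter_measure_cell w : nu (cell_itv w) = (cell_mass w)%:E.
Proof.
rewrite parameter_measureE setIidl; last exact: cell_itv_root.
have -> : cell_itv w = `[cell_left w, cell_left w + cell_mass w[%classic.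
  by apply/seteqP; split => x /=; rewrite in_itv.
rewrite lebesgue_measure_itv/= lte_fin -EFinB.
have := cell_mass_ge0 w; rewrite le_eqVlt => /predU1P[<-|m0].
  by rewrite addr0 ltxx.
by rewrite ltrDl m0 addrAC subrr add0r.
Qed.

Lemma parameter_measure_setT : nu setT = (cell_mass [::])%:E.
Proof. by rewrite -parameter_measure_cell !parameter_measureE setTI setIid. Qed.

Lemma measurable_continuous (f : X -> R) : continuous f ->
  measurable_fun setT (f : g_sigma_algebraType (@open X) -> R).
Proof.
move=> cf; apply: (measurability (@RGenOpens.G R)); first exact: RGenOpens.measurableE.
move=> _ [_ [a [b ->]] <-]; rewrite setTI; apply: sub_sigma_algebra.
by move/continuousP : cf; apply; exact: interval_open.
Qed.

Lemma measurable_continuous_decode (f : X -> R) : continuous f ->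
  measurable_fun setT (f \o decode : measurableTypeR R -> R).
Proof.
move=> cf; apply: (measurableT_comp _ measurable_decode).
exact: measurable_continuous.
Qed.

Lemma integrable_continuous_decode (f : X -> R) A : continuous f -> measurable A ->
  nu.-integrable A (EFin \o (f \o decode)).
Proof.
move=> cf mA; have [M fM] := compact_continuous_bounded cX cf.
apply: measurable_bounded_integrable => //.
- rewrite (@le_lt_trans _ _ (nu setT))//; last by rewrite parameter_measure_setT ltry.
  by apply: le_measure; rewrite ?inE.
- by apply: measurable_funTS; exact: measurable_continuous_decode.
- exists M; split; first exact: num_real.
  by move=> y My t _ /=; apply: le_trans (fM _) (ltW My).
Qed.

(** Both sides are additive under splitting a cell, which reduces the estimate
    to cells of depth [k], where [f] is almost constant. *)
Lemma integral_cell (f : X -> R) (e : R) k w : continuous f -> 0 < e ->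
  (forall w, size w = k -> forall x y : X,
    closure (cell w) x -> closure (cell w) y -> `|f x - f y| <= e) ->
  (size w <= k)%N ->
  `|\int[nu]_(t in cell_itv w) f (decode t) - l (fun x => f x * \1_(cell w) x)|
    <= 2 * e * cell_mass w.
Proof.
move=> cf e0 osc; have [lD lZ l0] := lpos.
have bf := compact_continuous_bounded cX cf.
have bfw v := bounded_on_mul bf (bounded_on_indic (cell v)).
have [n] := ubnP (k - size w)%N; elim: n w => // n IH w kwn wk.
move: wk; rewrite leq_eqVlt => /predU1P[wk|wk]; last first.
  have kn b : (k - size (b :: w) < n)%N.
    by rewrite /= subnS prednK ?subn_gt0// -ltnS (leq_trans _ kwn)// ltnS leqnn.
  have IH0 := IH (false :: w) (kn false) wk.
  have IH1 := IH (true :: w) (kn true) wk.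
  have -> : cell_itv w = cell_itv (false :: w) `|` cell_itv (true :: w).
    apply/seteqP; split => t.
      by move/cell_itv_split; case: (_ <= t); [right|left].
    by case=> /cell_itv_tail[].
  rewrite Rintegral_setU; [|exact: measurable_cell_itv|exact: measurable_cell_itv| |].
  - have -> : (fun x => f x * \1_(cell w) x) = (fun x =>
        f x * \1_(cell (false :: w)) x + f x * \1_(cell (true :: w)) x).
      by apply/funext => x; rewrite -mulrDr (cell_indic w).
    rewrite lD// (cell_mass_split w) opprD addrACA mulrDr.
    by apply: le_trans (ler_normD _ _) (lerD IH0 IH1).
  - apply: integrable_continuous_decode => //.
    by apply: measurableU; exact: measurable_cell_itv.
  - apply/disj_setPS => t [/cell_itv_tail[_ t0] /cell_itv_tail[_]].
    by rewrite -t0.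
have [cw0|/set0P[x0 wx0]] := eqVneq (cell w) set0.
  have w0 : cell_itv w = set0.
    by apply/seteqP; split => // t /cell_itv_nonempty[x]; rewrite cw0.
  rewrite w0 Rintegral_set0 /cell_mass cw0 indic0 (functional0 lpos).
  have -> : (fun x : X => f x * 0) = (fun=> 0) by apply/funext => x; rewrite mulr0.
  by rewrite (functional0 lpos) subrr normr0 mulr0.
(* Integral and functional both differ from [f x0 * cell_mass w] by at most
   [e * cell_mass w]. *)
have cst_int : \int[nu]_(t in cell_itv w) f x0 = f x0 * cell_mass w.
  by rewrite (Rintegral_cst _ (measurable_cell_itv w)) parameter_measure_cell.
have int_cst (c : R) : nu.-integrable (cell_itv w) (EFin \o (fun=> c)).
  apply: measurable_bounded_integrable => //; first exact: measurable_cell_itv.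
    by rewrite parameter_measure_cell ltry.
  by exists `|c|; split; [exact: num_real|move=> y cy t _; exact: ltW].
have mw := measurable_cell_itv w.
have int1 : `|\int[nu]_(t in cell_itv w) f (decode t) - f x0 * cell_mass w| <= e * cell_mass w.
  have int_f := integrable_continuous_decode cf mw.
  rewrite -cst_int -RintegralB//.
  have := @le_normr_Rintegral _ _ _ nu _ (fun t => f (decode t) - f x0) mw.
  move=> h; apply: le_trans (h _) _.
    exact: (integrableB mw int_f (int_cst _)).
  have int_d := integrableB mw int_f (int_cst (f x0)).
  have le_e : \int[nu]_(t in cell_itv w) `|f (decode t) - f x0| <=
      \int[nu]_(t in cell_itv w) e.
    apply: le_Rintegral => //; first exact: (integrable_norm int_d).
    move=> t wt; apply: (osc w wk); last exact: subset_closure.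
    rewrite -{1}(word_uniq wt); apply: decodeP; exact: cell_itv_root wt.
  by apply: le_trans le_e _; rewrite Rintegral_cst// parameter_measure_cell.
have int2 : `|l (fun x => f x * \1_(cell w) x) - f x0 * cell_mass w| <= e * cell_mass w.
  have b1 := bounded_on_indic (cell w).
  have close x : cell w x -> `|f x - f x0| <= e.
    by move=> wx; apply: (osc w wk); exact: subset_closure.
  rewrite ler_distl; apply/andP; split.
    rewrite -mulrBl /cell_mass -lZ//.
    apply: functional_le => //; first exact: bounded_on_scale.
    move=> x; rewrite indicE; have [/set_mem wx|_] := boolP (x \in cell w);
      last by rewrite !mulr0.
    by have := close _ wx; rewrite !mulr1 ler_norml => /andP[? ?]; lra.
  rewrite -mulrDl /cell_mass -lZ//.
  apply: functional_le => //; first exact: bounded_on_scale.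
  move=> x; rewrite indicE; have [/set_mem wx|_] := boolP (x \in cell w);
    last by rewrite !mulr0.
  by have := close _ wx; rewrite !mulr1 ler_norml => /andP[? ?]; lra.
have := ler_distD (f x0 * cell_mass w) (\int[nu]_(t in cell_itv w) f (decode t))
  (l (fun x => f x * \1_(cell w) x)).
rewrite (distrC (f x0 * _)); lra.
Qed.

Theorem riesz_representation :
  exists mu : {measure set (g_sigma_algebraType (@open X)) -> \bar R},
    mu setT = (l (fun=> 1))%:E /\
    forall f : X -> R, continuous f -> \int[mu]_(x in setT) f x = l f.
Proof.
have [lD lZ l0] := lpos.
(* The image measure, given together with the measurability of [decode]. *)
exists (measure_function_pushforward__canonical__measure_function_Measure nu
  measurable_decode); split.
  by rewrite /= /pushforward preimage_setT parameter_measure_setT /cell_mass /= indicT.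
move=> f cf.
rewrite /Rintegral (integral_pushforward measurable_decode)//; first last.
- by rewrite preimage_setT; apply: integrable_continuous_decode.
- by apply/measurable_EFinP; exact: measurable_continuous.
rewrite preimage_setT (@negligible_integral _ _ _ nu setT (~` cell_itv [::]))//;
    first last.
- by rewrite parameter_measureE setICl measure0.
- by apply: integrable_continuous_decode.
- by apply: measurableC; exact: measurable_cell_itv.
rewrite setTD setCK -[fine _]/(\int[nu]_(t in cell_itv [::]) f (decode t)).
apply/eqP; rewrite -subr_eq0 -normr_le0; apply/ler_addgt0Pr => e e0.
pose m := cell_mass [::] + 1.
have m0 : 0 < m by rewrite ltr_wpDl// cell_mass_ge0.
have d0 : 0 < e / (2 * m) by rewrite divr_gt0// mulr_gt0.
have [k osc] := cell_oscillation cf d0.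
have := integral_cell cf d0 osc (leq0n _ : (size [::] <= k)%N).
have -> : (fun x => f x * \1_(cell [::]) x) = f.
  by apply/funext => x; rewrite /= indicT mulr1.
move=> h; apply: le_trans h _; rewrite add0r.
have -> : 2 * (e / (2 * m)) = e / m by field; rewrite gt_eqF.
rewrite -mulrA; apply: ler_piMr; first exact: ltW.
rewrite mulrC ler_pdivrMr// mul1r.
by rewrite lerDl.
Qed.

End RieszMarkov.

(** * The torus and its smooth test functions *)

Section TorusTopology.
Context {R : realType} {n : nat}.
Local Notation T := (torus R n).
Local Open Scope quotient_scope.

Lemma torus_piP (a b : 'rV[R]_n) : (\pi_T a = \pi_T b) <-> torus_rel a b.
Proof.
split=> [h|h]; last by apply/eqmodP.
by have /eqmodP := h.
Qed.

Lemma torus_pi_repr (a : 'rV[R]_n) : torus_rel (repr (\pi_T a)) a.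
Proof. by apply/torus_piP; rewrite reprK. Qed.

Lemma translation_continuous (w : 'rV[R]_n) : continuous (fun x : 'rV[R]_n => x + w).
Proof. by move=> x; apply: continuousD; [exact: cvg_id|exact: cst_continuous]. Qed.

(** The saturation of an open set is a union of its translates. *)
Lemma torus_pi_open (V : set 'rV[R]_n) : open V -> open (\pi_T @` V).
Proof.
move=> oV; suff : open (\pi_T @^-1` (\pi_T @` V)) by [].
rewrite openE => a [v Vv /torus_piP va].
have shift_cont := @translation_continuous (v - a).
have : nbhs a ((fun x => x + (v - a)) @^-1` V).
  by apply: shift_cont; rewrite addrC subrK; exact: open_nbhs_nbhs.
apply: filterS => x Vx; exists (x + (v - a)) => //.
apply/torus_piP/forallP => k; have /forallP/(_ k) := va.
by rewrite !mxE addrAC subrr add0r.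
Qed.

Lemma torus_pi_continuous : continuous (\pi_T : 'rV[R]_n -> T).
Proof. exact: pi_continuous. Qed.

Lemma torus_pi_nbhs (a : 'rV[R]_n) (V : set 'rV[R]_n) :
  nbhs a V -> nbhs (\pi_T a) (\pi_T @` V).
Proof.
rewrite !nbhsE => -[U [oU Ua] UV]; exists (\pi_T @` U); last exact: image_subset.
by split; [exact: torus_pi_open|exists a].
Qed.

Lemma torus_compact : compact [set: T].
Proof.
pose cube := [set v : 'rV[R]_n | forall i, `[0, 1]%classic (v ord0 i)].
have cc : compact cube.
  by apply: (@rV_compact R n (fun=> `[0, 1]%classic)) => i; exact: segment_compact.
have -> : [set: T] = \pi_T @` cube.
  apply/seteqP; split => // x _.
  exists (\row_k (repr x 0 k - (Num.floor (repr x 0 k))%:~R)).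
    move=> k /=; rewrite mxE in_itv/= subr_ge0 ge_floor/= lerBlDl.
    by have := floorD1_gt (repr x 0 k); rewrite intrD => /ltW; rewrite addrC.
  rewrite -[RHS]reprK; apply/torus_piP/forallP => k; rewrite mxE addrAC subrr.
  by rewrite add0r rpredN intr_int.
apply: continuous_compact => //; apply: continuous_subspaceT.
exact: torus_pi_continuous.
Qed.

(** Continuity can be tested on lifts because the projection is open. *)
Lemma continuous_torusX (Z : topologicalType) (F : T * T -> Z) :
  continuous (fun p : 'rV[R]_n * 'rV[R]_n => F (\pi_T p.1, \pi_T p.2)) ->
  continuous F.
Proof.
move=> cF [x y] W; rewrite -[x]reprK -[y]reprK => FW.
have [[V1 V2] /= [V1x V2y] VW] := cF (repr x, repr y) W FW.
exists (\pi_T @` V1, \pi_T @` V2).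
  by split; exact: torus_pi_nbhs.
by move=> [_ _] [/= [a aV <-] [b bV <-]]; apply: (VW (a, b)).
Qed.

End TorusTopology.

Section TorusSeparation.
Context {R : realType} {n : nat}.
Local Notation T := (torus R n).
Local Open Scope quotient_scope.

(** A smooth substitute for the squared distance on the circle: it has period
    one and vanishes at the integers only. *)
Definition sinsq (t : R) : R := sin (pi * t) ^+ 2.

Definition dsinsq (t : R) : R := 2 * pi * (sin (pi * t) * cos (pi * t)).

Lemma sinsqD_int (t s : R) : s \is a Num.int -> sinsq (t + s) = sinsq t.
Proof.
have nat_case k u : sinsq (u + k%:R) = sinsq u.
  elim: k => [|k IH]; first by rewrite addr0.
  by rewrite -IH /sinsq -[k.+1]addn1 natrD addrA mulrDr mulr1 sinDpi sqrrN.
move=> /intrP[[k|k] ->]; first by rewrite -pmulrn nat_case.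
by rewrite NegzE mulrNz -(nat_case k.+1 (t - _)) -pmulrn subrK.
Qed.

Lemma sinsq_eq0 (t : R) : sinsq t = 0 -> t \is a Num.int.
Proof.
pose f := Num.floor t; pose r := t - f%:~R.
have r0 : 0 <= r by rewrite subr_ge0 ge_floor.
have r1 : r < 1 by rewrite ltrBlDl; have := floorD1_gt t; rewrite intrD.
have -> : t = r + f%:~R by rewrite subrK.
rewrite sinsqD_int ?intr_int// => /eqP; rewrite sqrf_eq0 => /eqP s0.
have [r00|rpos] := eqVneq r 0; first by rewrite r00 add0r intr_int.
have : 0 < sin (pi * r).
  have rgt0 : 0 < r by rewrite lt_neqAle eq_sym rpos.
  apply: sin_gt0_pi; rewrite mulr_gt0 ?pi_gt0//=.
  by rewrite -[X in _ < X]mulr1 ltr_pM2l// pi_gt0.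
by rewrite s0 ltxx.
Qed.

Lemma dsinsqN t : dsinsq (- t) = - dsinsq t.
Proof. by rewrite /dsinsq mulrN sinN cosN mulNr mulrN. Qed.

Lemma sinsqN t : sinsq (- t) = sinsq t.
Proof. by rewrite /sinsq mulrN sinN sqrrN. Qed.

Lemma is_derive_sinsq (c t : R) :
  is_derive t 1 (fun u => sinsq (u - c)) (dsinsq (t - c)).
Proof.
rewrite /sinsq /dsinsq.
have h : is_derive t (1 : R) (fun u => sin (pi * (u - c))) (cos (pi * (t - c)) * pi).
  apply: is_derive1_comp.
  by apply: is_derive_eq; rewrite /= /GRing.scale/=; ring.
have -> : (fun u => sin (pi * (u - c)) ^+ 2) =
    (fun u => sin (pi * (u - c))) * (fun u => sin (pi * (u - c))).
  by apply/funext => u; rewrite expr2.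
have h2 := is_deriveM h h; apply: is_derive_eq.
by rewrite /GRing.scale/=; ring.
Qed.

Lemma continuous_sin_pi : continuous (fun t : R => sin (pi * t)).
Proof.
by move=> t; apply: continuous_comp; [exact: mulrl_continuous|exact: continuous_sin].
Qed.

Lemma continuous_cos_pi : continuous (fun t : R => cos (pi * t)).
Proof.
by move=> t; apply: continuous_comp; [exact: mulrl_continuous|exact: continuous_cos].
Qed.

Lemma continuous_sinsq : continuous sinsq.
Proof.
have -> : sinsq = (fun t => sin (pi * t) * sin (pi * t)).
  by apply/funext => t; rewrite /sinsq expr2.
by move=> t; apply: continuousM; exact: continuous_sin_pi.
Qed.

Lemma continuous_dsinsq : continuous dsinsq.
Proof.
move=> t.
apply: (@continuousM _ _ (fun=> 2 * pi) (fun t => sin (pi * t) * cos (pi * t))).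
  exact: cst_continuous.
by apply: continuousM; [exact: continuous_sin_pi|exact: continuous_cos_pi].
Qed.

Definition torus_sep (x y : T) : R := \sum_k sinsq (repr x 0 k - repr y 0 k).

Lemma torus_sep_pi a b : torus_sep (\pi_T a) (\pi_T b) = \sum_k sinsq (a 0 k - b 0 k).
Proof.
apply: eq_bigr => k _.
have /forallP/(_ k) ha := torus_pi_repr a; have /forallP/(_ k) hb := torus_pi_repr b.
rewrite -(@sinsqD_int (a 0 k - b 0 k)
  ((repr (\pi_T a) 0 k - a 0 k) - (repr (\pi_T b) 0 k - b 0 k))).
  by congr sinsq; ring.
exact: rpredB.
Qed.

Lemma torus_sepC x y : torus_sep x y = torus_sep y x.
Proof. by apply: eq_bigr => k _; rewrite -sinsqN opprB. Qed.

Lemma torus_sep_ge0 x y : 0 <= torus_sep x y.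
Proof. by apply: sumr_ge0 => k _; rewrite sqr_ge0. Qed.

Lemma torus_sep_eq0 x y : torus_sep x y = 0 -> x = y.
Proof.
move=> /eqP; rewrite psumr_eq0 => [/allP s0|k _]; last exact: sqr_ge0.
rewrite -[x]reprK -[y]reprK; apply/torus_piP/forallP => k.
by apply: sinsq_eq0; apply/eqP; apply: s0; rewrite mem_index_enum.
Qed.

Lemma torus_sepxx x : torus_sep x x = 0.
Proof. by apply: big1 => k _; rewrite subrr /sinsq mulr0 sin0 expr0n. Qed.

Lemma torus_sep_continuous : continuous (fun p : T * T => torus_sep p.1 p.2).
Proof.
apply: continuous_torusX => /=.
under eq_fun do rewrite torus_sep_pi.
apply: continuous_big; first exact: add_continuous.
move=> k _ p.
apply: (@continuous_comp _ _ _ (fun p : 'rV[R]_n * 'rV[R]_n => p.1 0 k - p.2 0 k) sinsq);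
  last exact: continuous_sinsq.
have c1 : continuous (fun a : 'rV[R]_n => a 0 k) by exact: coord_continuous.
apply: continuousB.
  by apply: (@continuous_comp _ _ _ fst (fun a : 'rV[R]_n => a 0 k)); [exact: cvg_fst|exact: c1].
by apply: (@continuous_comp _ _ _ snd (fun a : 'rV[R]_n => a 0 k)); [exact: cvg_snd|exact: c1].
Qed.

End TorusSeparation.

Section TorusGradient.
Context {R : realType} {n : nat}.
Local Notation T := (torus R n).
Local Open Scope quotient_scope.

Lemma continuous_row (Z : topologicalType) (F : Z -> 'I_n -> R) :
  (forall k, continuous (F ^~ k)) -> continuous (fun z => \row_k F z k).
Proof.
move=> cF z A [P Pz PA].
have : \forall w \near z, forall k, P 0 k (F w k).
  apply: filter_forall => k; apply: cF.
  by have := Pz 0 k; rewrite mxE.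
apply: filterS => w Pw; apply: PA => i k; rewrite mxE (ord1 i); exact: Pw.
Qed.

Lemma grad_lift_periodic (f : T -> R) a b : \pi_T a = \pi_T b ->
  grad (lift_torus f) a = grad (lift_torus f) b.
Proof.
move=> ab; apply/rowP => k; rewrite !mxE /derive.
set g1 := (fun h : R => h^-1 *: _); set g2 := (fun h : R => h^-1 *: _).
suff -> : g1 = g2 by [].
apply/funext => h; rewrite /g1 /g2 /= /lift_torus ab; congr (_ *: (f _ - _)).
apply/torus_piP/forallP => j; have /torus_piP/forallP/(_ j) := ab.
by rewrite !mxE opprD addrACA subrr add0r.
Qed.

Lemma torus_grad_pi (f : T -> R) a : torus_grad f (\pi_T a) = grad (lift_torus f) a.
Proof. by apply: grad_lift_periodic; rewrite reprK. Qed.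

Lemma torus_grad_continuous (f : T -> R) : torus_C1 f -> continuous (torus_grad f).
Proof.
move=> [_ cg]; apply/quotient_continuous.
have -> : torus_grad f \o \pi_T = grad (lift_torus f).
  by apply/funext => a; exact: torus_grad_pi.
exact: cg.
Qed.

Lemma gradD (f g : 'rV[R]_n -> R) a :
  differentiable (f : _ -> R^o) a -> differentiable (g : _ -> R^o) a ->
  grad (fun x => f x + g x) a = grad f a + grad g a.
Proof.
by move=> df dg; apply/rowP => k; rewrite !mxE; apply: deriveD; exact: diff_derivable.
Qed.

Lemma gradZ (c : R) (f : 'rV[R]_n -> R) a :
  differentiable (f : _ -> R^o) a ->
  grad (fun x => c * f x) a = c *: grad f a.
Proof.
by move=> df; apply/rowP => k; rewrite !mxE; apply: deriveZ; exact: diff_derivable.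
Qed.

Lemma torus_C1D (f g : T -> R) : torus_C1 f -> torus_C1 g ->
  torus_C1 (fun x => f x + g x).
Proof.
move=> [df cf] [dg cg]; split; first by move=> a; apply: differentiableD.
have -> : grad (lift_torus (fun x => f x + g x)) =
    (fun a => grad (lift_torus f) a + grad (lift_torus g) a).
  by apply/funext => a; exact: gradD.
by move=> a; apply: continuousD; [exact: cf|exact: cg].
Qed.

Lemma torus_C1Z c (f : T -> R) : torus_C1 f -> torus_C1 (fun x => c * f x).
Proof.
move=> [df cf]; split; first by move=> a; apply: differentiableZ.
have -> : grad (lift_torus (fun x => c * f x)) = (fun a => c *: grad (lift_torus f) a).
  by apply/funext => a; exact: gradZ.
move=> a; apply: (@continuousZ _ _ _ (fun=> c)); first exact: cst_continuous.
exact: cf.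
Qed.

Lemma torus_gradD (f g : T -> R) x : torus_C1 f -> torus_C1 g ->
  torus_grad (fun x => f x + g x) x = torus_grad f x + torus_grad g x.
Proof. by move=> [df _] [dg _]; exact: gradD. Qed.

Lemma torus_gradZ c (f : T -> R) x : torus_C1 f ->
  torus_grad (fun x => c * f x) x = c *: torus_grad f x.
Proof. by move=> [df _]; exact: gradZ. Qed.

Lemma lift_torus_sep y : lift_torus (torus_sep ^~ y) =
  (fun a : 'rV[R]_n => \sum_k sinsq (a 0 k - repr y 0 k)).
Proof. by apply/funext => a; rewrite /lift_torus -{1}[y]reprK torus_sep_pi. Qed.

Lemma differentiable_sep_term (y a : 'rV[R]_n) k :
  differentiable (fun a : 'rV[R]_n => sinsq (a 0 k - y 0 k) : R^o) a.
Proof.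
apply: (@differentiable_comp _ _ _ _ (fun a : 'rV[R]_n => a 0 k : R^o)
  (fun t => sinsq (t - y 0 k))); first exact: differentiable_coord.
apply/derivable1_diffP; have dterm := is_derive_sinsq (y 0 k) (a 0 k).
exact: ex_derive.
Qed.

Lemma diff_coord (a v : 'rV[R]_n) k : 'd (fun b : 'rV[R]_n => b 0 k : R^o) a v = v 0 k.
Proof.
have coord_linear : linear (fun b : 'rV[R]_n => b 0 k : R^o).
  by move=> c u w; rewrite !mxE.
pose coordM := GRing.isLinear.Build _ _ _ _ _ coord_linear.
pose coordL : {linear 'rV[R]_n -> R^o} := HB.pack (fun b : 'rV[R]_n => b 0 k : R^o) coordM.
rewrite -[fun b : 'rV[R]_n => _]/(coordL : _ -> _) diff_lin//.
exact: coord_continuous.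
Qed.

Lemma derive_sep_term (y a : 'rV[R]_n) j k :
  'D_(delta_mx 0 j) (fun a : 'rV[R]_n => sinsq (a 0 k - y 0 k) : R^o) a =
  dsinsq (a 0 k - y 0 k) *+ (j == k).
Proof.
have dcoord := differentiable_coord a 0 k.
have dterm := is_derive_sinsq (y 0 k) (a 0 k).
have dsin : differentiable (fun t => sinsq (t - y 0 k)) (a 0 k).
  by apply/derivable1_diffP; exact: ex_derive.
rewrite deriveE; last exact: differentiable_sep_term.
rewrite (diff_comp dcoord dsin) /= (diff1E dsin) derive1E derive_val diff_coord.
by rewrite mxE eqxx /= eq_sym; case: eqP => _; rewrite ?scale1r ?scale0r.
Qed.

Lemma grad_sep (y : T) a : grad (lift_torus (torus_sep ^~ y)) a =
  \row_k dsinsq (a 0 k - repr y 0 k).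
Proof.
rewrite lift_torus_sep; apply/rowP => j; rewrite !mxE.
have -> : (fun a : 'rV[R]_n => \sum_k sinsq (a 0 k - repr y 0 k)) =
    \sum_k (fun a : 'rV[R]_n => sinsq (a 0 k - repr y 0 k) : R^o).
  by apply/funext => b; rewrite fct_sumE.
rewrite derive_sum; last by move=> k; apply/diff_derivable/differentiable_sep_term.
under eq_bigr do rewrite derive_sep_term.
by rewrite (bigD1 j)//= eqxx big1 ?addr0// => k /negbTE kj; rewrite eq_sym kj.
Qed.

Lemma torus_C1_sep (y : T) : torus_C1 (torus_sep ^~ y).
Proof.
split=> [a|].
  rewrite lift_torus_sep.
  have -> : (fun a : 'rV[R]_n => \sum_k sinsq (a 0 k - repr y 0 k)) =
      \sum_k (fun a : 'rV[R]_n => sinsq (a 0 k - repr y 0 k) : R^o).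
    by apply/funext => b; rewrite fct_sumE.
  by apply: differentiable_sum => k; exact: differentiable_sep_term.
have -> : grad (lift_torus (torus_sep ^~ y)) =
    (fun a => \row_k dsinsq (a 0 k - repr y 0 k)).
  by apply/funext => a; exact: grad_sep.
apply: continuous_row => k a.
apply: (@continuous_comp _ _ _ (fun a : 'rV[R]_n => a 0 k - repr y 0 k) dsinsq);
  last exact: continuous_dsinsq.
apply: (@continuousB _ _ _ (fun a : 'rV[R]_n => a 0 k) (fun=> repr y 0 k)).
  exact: coord_continuous.
exact: cst_continuous.
Qed.

Lemma torus_grad_sep (x y : T) :
  torus_grad (torus_sep ^~ y) x = \row_k dsinsq (repr x 0 k - repr y 0 k).
Proof. exact: grad_sep. Qed.

(** At a doubled maximum point the two test gradients coming from the penalty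
    are opposite. *)
Lemma torus_grad_sepC (x y : T) :
  torus_grad (torus_sep ^~ x) y = - torus_grad (torus_sep ^~ y) x.
Proof. by apply/rowP => k; rewrite !torus_grad_sep !mxE -dsinsqN opprB. Qed.

Lemma torus_grad_sepxx (x : T) : torus_grad (torus_sep ^~ x) x = 0.
Proof.
by apply/rowP => k; rewrite torus_grad_sep !mxE subrr /dsinsq mulr0 sin0 mul0r mulr0.
Qed.

End TorusGradient.

(** * Countable regular families *)

Lemma regular_family_count (X : topologicalType) (I : countType) (A : I -> set X) :
  (forall (x : X) (U : set X), nbhs x U ->
    exists i, nbhs x (A i) /\ closure (A i) `<=` U) ->
  exists C : nat -> set X, regular_family C.
Proof.
move=> regA; exists (fun j => if unpickle j is Some i then A i else set0) => x U.
by move=> /regA[i iP]; exists (pickle i); rewrite pickleK.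
Qed.

Lemma regular_family_prod (X Y : topologicalType) (A : nat -> set X)
    (B : nat -> set Y) : regular_family A -> regular_family B ->
  exists C : nat -> set (X * Y), regular_family C.
Proof.
move=> regA regB.
apply: (@regular_family_count _ (nat * nat)%type (fun ij => A ij.1 `*` B ij.2)).
move=> [x y] U [[V W] /= [/regA[i [xi iV]] /regB[j [yj jW]]] VWU].
exists (i, j); split=> /=; first by exists (A i, B j).
move=> [a b] ab; apply: VWU; split=> /=.
  apply: iV => N aN; have [|[a' b'] [[/= Aa' _] [/= Na' _]]] := ab (N `*` setT).
    by exists (N, setT) => //; split=> //=; exact: filterT.
  by exists a'.
apply: jW => N bN; have [|[a' b'] [[/= _ Bb'] [/= _ Nb']]] := ab (setT `*` N).
  by exists (setT, N) => //; split=> //=; exact: filterT.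
by exists b'.
Qed.

Lemma regular_family_compact_metric (R : realType) (X : pmetricType R) :
  compact [set: X] -> exists C : nat -> set X, regular_family C.
Proof.
move=> /compact_second_countable[B cB [openB basisB]].
move/pfcard_geP : cB => [B0|[f]].
  exists (fun=> set0) => x U xU; have [V] := basisB x _ xU.
  by rewrite B0 => -[[]].
exists f => x U /uniform_regular [V xV VU].
have [W [BW Wx] WV] := basisB x _ xV.
have [j _ jW] := @surj _ _ _ _ f _ BW.
exists j; rewrite jW; split; first exact/open_nbhs_nbhs/(conj (openB _ BW)).
exact: subset_trans (closureS WV) VU.
Qed.

Section TorusFamily.
Context {R : realType} {n : nat}.
Local Notation T := (torus R n).
Local Open Scope quotient_scope.

Lemma rat_row_dense (a : 'rV[R]_n) (r : R) : 0 < r ->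
  exists q : 'rV[rat]_n, ball a r (map_mx ratr q).
Proof.
move=> r0.
have near_rat k : exists q : rat, `|a 0 k - ratr q| < r.
  have [|q] := @rat_in_itvoo R (a 0 k - r) (a 0 k + r).
    by rewrite ltrBlDr -addrA ltrDl addr_gt0.
  by rewrite in_itv/= => qr; exists q; rewrite distrC ltr_distl.
have [q qr] := choice near_rat.
exists (\row_k q k); split=> // i j; rewrite !mxE (ord1 i); exact: qr.
Qed.

(** A point in the closure of the image of a ball is congruent to a point at
    distance less than the radius from the ball, because the projection is open. *)
Lemma closure_torus_ball (q : 'rV[R]_n) (r : R) : 0 < r ->
  closure (\pi_T @` ball q r) `<=` \pi_T @` ball q (r + r).
Proof.
move=> r0 y; rewrite -[y]reprK => /(_ _ (torus_pi_nbhs (nbhsx_ballx (repr y) r r0))).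
move=> [_ [[b qb <-] [c yc cb]]].
exists (repr y + (b - c)).
  apply: (ball_triangle qb); split=> // i j; have [_ /(_ i j)] := yc.
  rewrite /ball/= !mxE => ycij.
  have -> : b i j - (repr y i j + (b i j - c i j)) = - (repr y i j - c i j) by ring.
  by rewrite normrN.
apply/torus_piP/forallP => k; have /torus_piP/forallP/(_ k) := cb.
by rewrite !mxE addrAC subrr add0r -opprB rpredN.
Qed.

(** Images of balls with rational centres and radii [1 / (N + 1)]. *)
Lemma regular_family_torus : exists C : nat -> set T, regular_family C.
Proof.
apply: (@regular_family_count _ ('rV[rat]_n * nat)%type
  (fun qN => \pi_T @` ball (map_mx ratr qN.1 : 'rV[R]_n) (qN.2.+1%:R^-1))).
move=> x U; rewrite -[x]reprK => /torus_pi_continuous/nbhs_ballP[e /= e0 eU].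
have e30 : 0 < e / 3 by rewrite divr_gt0.
have [N N_lt] : exists N : nat, N.+1%:R^-1 < e / 3.
  have := near_infty_natSinv_lt (PosNum e30).
  by move=> [N _ /(_ N (leqnn N))]; exists N.
set r := N.+1%:R^-1 in N_lt; have r0 : 0 < r by rewrite invr_gt0.
have [q xq] := rat_row_dense (repr x) r0.
exists (q, N); split=> /=; rewrite -/r.
  apply: torus_pi_nbhs; apply: open_nbhs_nbhs; split; first exact: ball_open.
  exact: ball_sym.
apply: subset_trans (closure_torus_ball r0) _ => _ [z qz <-]; apply: eU.
apply: (@le_ball _ _ _ (r + (r + r))); first by move: N_lt; lra.
exact: ball_triangle xq qz.
Qed.

End TorusFamily.

(** * Doubling of variables *)

Lemma continuous_compose (X Y Z : topologicalType) (f : X -> Y) (h : Y -> Z) :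
  continuous f -> continuous h -> continuous (fun x => h (f x)).
Proof. by move=> cf ch x; apply: continuous_comp; [exact: cf|exact: ch]. Qed.

Lemma continuous_pairing (X Y Z : topologicalType) (f : X -> Y) (h : X -> Z) :
  continuous f -> continuous h -> continuous (fun x => (f x, h x)).
Proof. by move=> cf ch x; apply: cvg_pair; [exact: cf|exact: ch]. Qed.

Lemma continuous_constant (X Y : topologicalType) (y : Y) :
  continuous (fun _ : X => y).
Proof. by move=> x; exact: cvg_cst. Qed.

Lemma continuous_identity (X : topologicalType) : continuous (fun x : X => x).
Proof. by move=> x; exact: cvg_id. Qed.

Section RealContinuity.
Context {R : realType} {X : topologicalType}.
Implicit Types f h : X -> R.

Lemma continuous_addf f h : continuous f -> continuous h ->
  continuous (fun x => f x + h x).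
Proof. by move=> cf ch x; apply: continuousD; [exact: cf|exact: ch]. Qed.

Lemma continuous_subf f h : continuous f -> continuous h ->
  continuous (fun x => f x - h x).
Proof. by move=> cf ch x; apply: continuousB; [exact: cf|exact: ch]. Qed.

Lemma continuous_mulf f h : continuous f -> continuous h ->
  continuous (fun x => f x * h x).
Proof. by move=> cf ch x; apply: continuousM; [exact: cf|exact: ch]. Qed.

End RealContinuity.


Section Doubling.
Context {R : realType} {n : nat}.
Local Notation T := (torus R n).
Local Open Scope quotient_scope.

Definition doubled (a b : T -> R) (N : R) (p : T * T) : R :=
  a p.1 + b p.2 - N * torus_sep p.1 p.2.

Lemma torus_compactX : compact [set: T * T].
Proof. by rewrite -setXTT; apply: compact_setX; exact: torus_compact. Qed.

Lemma compact_max (X : topologicalType) (x0 : X) (f : X -> R) : compact [set: X] ->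
  continuous f -> exists x, forall y, f y <= f x.
Proof.
move=> cX cf; have [|x _ xmax] := compact_EVT_max _ cX (continuous_subspaceT cf).
  by exists x0.
by exists x => y; apply: xmax; rewrite inE.
Qed.

Lemma doubled_continuous a b N : continuous a -> continuous b ->
  continuous (doubled a b N).
Proof.
move=> ca cb; apply: continuous_subf.
  apply: continuous_addf.
    by apply: continuous_compose ca => p; exact: cvg_fst.
  by apply: continuous_compose cb => p; exact: cvg_snd.
apply: continuous_mulf; [exact: continuous_constant|exact: torus_sep_continuous].
Qed.

(** At a maximum point the penalty [N * torus_sep] stays bounded as [N] grows,
    so by compactness the maximum points accumulate on the diagonal, and there
    at a maximum point of [a + b]. Neighbourhoods instead of subsequences let
    the conclusion pass to the limit in any continuous inequality. *)
Lemma doubling (a b : T -> R) : continuous a -> continuous b ->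
  exists z, (forall y, a y + b y <= a z + b z) /\
    forall W, nbhs (z, z) W -> exists N p, W p /\
      forall q, doubled a b N q <= doubled a b N p.
Proof.
move=> ca cb.
have cD N := @doubled_continuous a b N ca cb.
have [p pmax] := choice (fun N : nat => compact_max (\pi_T 0, \pi_T 0) torus_compactX (cD N%:R)).
have [z0 z0max] := compact_max (\pi_T 0) torus_compact (fun x => continuousD (ca x) (cb x)).
have [p0 p0max] := compact_max (\pi_T 0, \pi_T 0) torus_compactX (cD 0).
pose M := a z0 + b z0.
have pM N : M + N%:R * torus_sep (p N).1 (p N).2 <= a (p N).1 + b (p N).2.
  by have := pmax N (z0, z0); rewrite /doubled/= torus_sepxx mulr0 /M; lra.
have pK N : a (p N).1 + b (p N).2 <= a p0.1 + b p0.2.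
  by have := p0max (p N); rewrite /doubled !mul0r !subr0.
pose K := a p0.1 + b p0.2 - M.
have [[z z'] [_ clz]] : [set: T * T] `&` cluster (p @ \oo) !=set0.
  by apply: torus_compactX; exact: filterT.
(* Every neighbourhood of the cluster point contains [p N] for arbitrarily
   large [N]. *)
have hit W N0 : nbhs (z, z') W -> exists2 N, (N0 <= N)%N & W (p N).
  move=> zW; have [|_ [[N /= N0N <-] WN]] := clz [set p N | N in [set N | (N0 <= N)%N]] W _ zW.
    by exists N0 => // N N0N; exists N.
  by exists N.
have zz' : z = z'.
  apply: torus_sep_eq0; apply/eqP; rewrite eq_le torus_sep_ge0 andbT leNgt; apply/negP => s0.
  pose s := torus_sep z z'.
  have zW : nbhs (z, z') [set q | s / 2 < torus_sep q.1 q.2].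
    apply: (@torus_sep_continuous R n (z, z') [set r | s / 2 < r]).
    apply: open_nbhs_nbhs; split; first exact: open_gt.
    by rewrite /= -/s; move: s0; rewrite -/s; lra.
  have [N0 KN0] : exists N0 : nat, K < N0%:R * (s / 2).
    have s20 : 0 < s / 2 by rewrite divr_gt0.
    exists (Num.truncn (K / (s / 2))).+1; rewrite -ltr_pdivrMr//.
    exact: truncnS_gt.
  have [N N0N /= sN] := hit _ N0 zW.
  have : N0%:R * (s / 2) <= N%:R * torus_sep (p N).1 (p N).2.
    by apply: ler_pM; rewrite ?ler_nat// ?divr_ge0// ltW.
  by have := pM N; have := pK N; move: KN0; rewrite /K; lra.
exists z; split.
- move=> y; rewrite leNgt; apply/negP => yz.
  have zW : nbhs (z, z') [set q | doubled a b 0 q < M].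
    apply: (cD 0 (z, z') [set r | r < M]).
    apply: open_nbhs_nbhs; split; first exact: open_lt.
    rewrite /doubled/= mul0r subr0 -zz'; apply: lt_le_trans yz _; exact: z0max.
  have [N _ /=] := hit _ 0%N zW; rewrite /doubled mul0r subr0.
  have := pM N; have := mulr_ge0 (ler0n R N) (torus_sep_ge0 (p N).1 (p N).2); lra.
- move=> W; rewrite {2}zz' => zW; have [N _ WN] := hit _ 0%N zW.
  by exists N%:R, (p N); split.
Qed.

End Doubling.

(** * The convex cone of subsolutions *)

Section Euclid.
Context {R : realType} {n : nat}.
Implicit Types a b p : 'rV[R]_n.

Lemma dotvDl a b p : dotv (a + b) p = dotv a p + dotv b p.
Proof. by rewrite /dotv -big_split/=; apply: eq_bigr => k _; rewrite mxE mulrDl. Qed.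

Lemma dotvNl a p : dotv (- a) p = - dotv a p.
Proof. by rewrite /dotv -sumrN; apply: eq_bigr => k _; rewrite mxE mulNr. Qed.

Lemma dotvDr a b p : dotv p (a + b) = dotv p a + dotv p b.
Proof. by rewrite /dotv -big_split/=; apply: eq_bigr => k _; rewrite mxE mulrDr. Qed.

Lemma dotvZr (t : R) a p : dotv p (t *: a) = t * dotv p a.
Proof. by rewrite /dotv mulr_sumr; apply: eq_bigr => k _; rewrite mxE mulrCA. Qed.

Lemma dotvNr a p : dotv p (- a) = - dotv p a.
Proof. by rewrite -scaleN1r dotvZr mulN1r. Qed.

Lemma coord_le_enorm p k : `|p 0 k| <= enorm p.
Proof.
rewrite -sqrtr_sqr ler_wsqrtr// /dotv (bigD1 k)//= -expr2 lerDl.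
by apply: sumr_ge0 => j _; rewrite -expr2 sqr_ge0.
Qed.

(** Dual to the bound of the coordinates by [enorm]. *)
Definition norm1 a : R := \sum_k `|a 0 k|.

Lemma norm1_0 : norm1 0 = 0.
Proof. by apply: big1 => k _; rewrite mxE normr0. Qed.

Lemma dotv_le (r : R) a p : enorm p <= r -> `|dotv a p| <= r * norm1 a.
Proof.
move=> pr; rewrite /norm1 mulr_sumr; apply: le_trans (ler_norm_sum _ _ _) _.
apply: ler_sum => k _; rewrite normrM mulrC ler_wpM2r//.
exact: le_trans (coord_le_enorm p k) pr.
Qed.

Lemma continuous_coordf (Z : topologicalType) (f : Z -> 'rV[R]_n) k :
  continuous f -> continuous (fun z => f z 0 k).
Proof.
move=> cf z; apply: (@continuous_comp _ _ _ f (fun a : 'rV[R]_n => a 0 k)).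
  exact: cf.
exact: coord_continuous.
Qed.

Lemma continuous_dotv (Z : topologicalType) (f h : Z -> 'rV[R]_n) :
  continuous f -> continuous h -> continuous (fun z => dotv (f z) (h z)).
Proof.
move=> cf ch; apply: continuous_big; first exact: add_continuous.
move=> k _ z; apply: (@continuousM _ _ (fun z => f z 0 k) (fun z => h z 0 k)).
  exact: continuous_coordf.
exact: continuous_coordf.
Qed.

Lemma continuous_norm1B (Z : topologicalType) (f h : Z -> 'rV[R]_n) :
  continuous f -> continuous h -> continuous (fun z => norm1 (f z - h z)).
Proof.
move=> cf ch; rewrite /norm1; under eq_fun do under eq_bigr do rewrite !mxE.
apply: continuous_big; first exact: add_continuous.
move=> k _; apply: (continuous_compose (h := @Num.norm R R)); last exact: norm_continuous.
by apply: continuous_subf; exact: continuous_coordf.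
Qed.

End Euclid.

(** The tube lemma; it makes error terms small uniformly in the control. *)
Lemma tube_lt (R : realType) (Z Y : topologicalType) (F : Z * Y -> R) (z : Z) :
  compact [set: Y] -> continuous F -> (forall y, F (z, y) < 0) ->
  \forall w \near z, forall y, F (w, y) < 0.
Proof.
move=> /compact_near_coveringP cY cF Fz.
have h := cY Z (nbhs z) (fun w y => F (w, y) < 0) _.
have : \forall w \near z, [set: Y] `<=` (fun y => F (w, y) < 0).
  apply: h => y _.
  have [[V W] /= [zV yW] VW] : nbhs (z, y) [set q | F q < 0].
    apply: (cF (z, y) [set r | r < 0]); apply: open_nbhs_nbhs.
    by split; [exact: open_lt|exact: Fz].
  by exists (W, V) => // -[y' w'] [/= Wy' Vw']; exact: (VW (w', y')).
by apply: filterS => w hw y; exact: hw.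
Qed.

Section Subsolutions.
Context {R : realType} {m n : nat} {Xi : pmetricType R}.
Local Notation T := (torus R n).
Variables (g : 'I_m -> T * Xi -> 'rV[R]_n) (B : T -> 'M[R]_m).
Hypotheses (Xi_compact : compact [set: Xi])
  (g_cont : forall i, continuous (g i))
  (B_cont : forall i j, continuous (fun x => B x i j)).
Implicit Types (phi : 'I_m -> T * Xi -> R) (u v : 'I_m -> T -> R) (psi : T -> R).

Lemma continuous_slice (Y : topologicalType) (f : T * Xi -> Y) xi :
  continuous f -> continuous (fun x => f (x, xi)).
Proof.
move=> cf; apply: (continuous_compose _ cf).
by apply: continuous_pairing; [exact: continuous_identity|exact: continuous_constant].
Qed.

Lemma continuous_fiber (Y : topologicalType) (f : T * Xi -> Y) x :
  continuous f -> continuous (fun xi => f (x, xi)).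
Proof.
move=> cf; apply: (continuous_compose _ cf).
by apply: continuous_pairing; [exact: continuous_constant|exact: continuous_identity].
Qed.

Lemma coupling_continuous u i : (forall j, continuous (u j)) ->
  continuous (coupling B u i).
Proof.
move=> cu; apply: continuous_big; first exact: add_continuous.
by move=> j _; apply: continuous_mulf; [exact: B_cont|exact: cu].
Qed.

Lemma hamiltonian_ge phi i x p xi : continuous (phi i) ->
  - dotv (g i (x, xi)) p - phi i (x, xi) <= hamiltonian g phi i x p.
Proof.
move=> cphi; apply: ub_le_sup; last by exists xi.
have [|M fM] := @compact_continuous_bounded R Xi
    (fun xi => dotv (g i (x, xi)) p + phi i (x, xi)) Xi_compact.
  apply: continuous_addf; last exact: continuous_fiber.
  by apply: continuous_dotv; [exact: continuous_fiber|exact: continuous_constant].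
exists M => _ [eta _ <-]; have := fM eta; rewrite ler_norml => /andP[h _]; lra.
Qed.

Lemma hamiltonian_le phi i x p c :
  (forall xi, - dotv (g i (x, xi)) p - phi i (x, xi) <= c) ->
  hamiltonian g phi i x p <= c.
Proof.
move=> h; apply: ge_sup; first by exists (- dotv (g i (x, point)) p - phi i (x, point)), point.
by move=> _ [xi _ <-].
Qed.

(** The infimum in the coercivity assumption is a genuine lower bound of the
    Hamiltonian at every point: one fixed control already bounds the Hamiltonian
    from below uniformly on the torus. *)
Lemma coercive_bound phi i (c : R) : continuous (phi i) ->
  coercive (hamiltonian g phi) ->
  exists r, forall x p,
    (forall xi, - dotv (g i (x, xi)) p - phi i (x, xi) <= c) -> enorm p <= r.
Proof.
move=> cphi /(_ i) co.
have [|r _ rP] := co [set y | c < y].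
  by exists c; split; [exact: num_real|].
exists r => x p hp; rewrite leNgt; apply/negP => rp.
have := rP p rp => /=; apply/negP; rewrite -leNgt.
apply: le_trans (hamiltonian_le hp); apply: ge_inf; last by exists x.
have [|M fM] := @compact_continuous_bounded R T
    (fun x => dotv (g i (x, point)) p + phi i (x, point)) torus_compact.
  apply: continuous_addf; last exact: continuous_slice.
  by apply: continuous_dotv; [exact: continuous_slice|exact: continuous_constant].
exists (- M) => _ [y _ <-].
apply: le_trans (hamiltonian_ge y p point cphi).
by have := fM y; rewrite ler_norml => /andP[_ h]; lra.
Qed.

Lemma F0_touching phi u i psi x xi : F0 g B (phi, u) -> torus_C1 psi ->
  (forall y, u i y - psi y <= u i x - psi x) ->
  coupling B u i x - dotv (g i (x, xi)) (torus_grad psi x) - phi i (x, xi) <= 0.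
Proof.
move=> [/= cphi [_ sub]] psi1 touch; apply: le_trans (sub i psi x psi1 touch).
by rewrite -addrA lerD2l; exact: hamiltonian_ge.
Qed.

(** The Hamiltonians of [phi] and [L] differ by a bounded amount, so coercivity
    of the latter and the subsolution inequality bound all test gradients. This
    stands in for Lipschitz continuity of the subsolution. *)
Lemma F0_gradient_bound L phi u i : (forall j, continuous (L j)) ->
  coercive (hamiltonian g L) -> F0 g B (phi, u) ->
  exists r, forall psi x, torus_C1 psi ->
    (forall y, u i y - psi y <= u i x - psi x) -> enorm (torus_grad psi x) <= r.
Proof.
move=> cL co Fu; have [/= cphi [cu _]] := Fu.
have [M1 M1P] := compact_continuous_bounded torus_compact (coupling_continuous (i := i) cu).
have cX : compact [set: T * Xi].
  by rewrite -setXTT; apply: compact_setX; [exact: torus_compact|].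
have [M2 M2P] := compact_continuous_bounded cX (continuous_subf (cphi i) (cL i)).
have [r rP] := @coercive_bound L i (M1 + M2) (cL i) co.
exists r => psi x psi1 touch; apply: rP => xi.
have := F0_touching xi Fu psi1 touch.
have := M1P x; have := M2P (x, xi); rewrite !ler_norml => /andP[_ h2] /andP[h1 _].
lra.
Qed.

Lemma couplingD u v i x :
  coupling B (fun i x => u i x + v i x) i x = coupling B u i x + coupling B v i x.
Proof. by rewrite /coupling -big_split/=; apply: eq_bigr => j _; rewrite mulrDr. Qed.

Lemma couplingZ (t : R) u i x :
  coupling B (fun i x => t * u i x) i x = t * coupling B u i x.
Proof. by rewrite /coupling mulr_sumr; apply: eq_bigr => j _; rewrite mulrCA. Qed.

(** The supremum in the Hamiltonian splits into one inequality per control, each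
    linear in [phi] and in the gradient. *)
Lemma F0_intro phi u : (forall i, continuous (phi i)) ->
  (forall i, continuous (u i)) ->
  (forall i psi x xi, torus_C1 psi ->
    (forall y, u i y - psi y <= u i x - psi x) ->
    coupling B u i x - dotv (g i (x, xi)) (torus_grad psi x) - phi i (x, xi) <= 0) ->
  F0 g B (phi, u).
Proof.
move=> cphi cu h; split=> //; split=> //= i psi x psi1 touch.
rewrite -lerBrDl sub0r; apply: hamiltonian_le => xi.
by have := h i psi x xi psi1 touch; lra.
Qed.

Lemma F0_scale (t : R) phi u : 0 < t -> F0 g B (phi, u) ->
  F0 g B (fun i z => t * phi i z, fun i x => t * u i x).
Proof.
move=> t0 Fu; have [/= cphi [cu _]] := Fu.
apply: F0_intro => [i|i|i psi x xi psi1 touch].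
- by apply: continuous_mulf; [exact: continuous_constant|exact: cphi].
- by apply: continuous_mulf; [exact: continuous_constant|exact: cu].
have := @F0_touching phi u i (fun y => t^-1 * psi y) x xi Fu (torus_C1Z _ psi1).
have -> : torus_grad (fun y => t^-1 * psi y) x = t^-1 *: torus_grad psi x.
  exact: torus_gradZ.
rewrite couplingZ dotvZr => h.
have /h : forall y, u i y - t^-1 * psi y <= u i x - t^-1 * psi x.
  move=> y; rewrite -(ler_pM2l t0) !mulrBr !mulrA divff ?gt_eqF// !mul1r.
  exact: touch.
rewrite -(ler_pM2l t0) mulr0 !mulrBr mulrA divff ?gt_eqF// mul1r.
by [].
Qed.

(** The cone is convex because [H_phi] is convex in the gradient and linear in
    [phi]: at doubled maximum points the two test gradients are
    [D chi + D sep - q] and [q], and only their sum enters up to an error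
    [|g(x) - g(y)| * |q|], where [q] stays bounded by coercivity. *)
Lemma F0_add L phi1 u1 phi2 u2 : (forall j, continuous (L j)) ->
  coercive (hamiltonian g L) -> F0 g B (phi1, u1) -> F0 g B (phi2, u2) ->
  F0 g B (fun i z => phi1 i z + phi2 i z, fun i x => u1 i x + u2 i x).
Proof.
move=> cL co Fu1 Fu2; have [/= c1 [cu1 _]] := Fu1; have [/= c2 [cu2 _]] := Fu2.
apply: F0_intro => [i|i|i chi x0 xi chi1 touch].
- exact: continuous_addf.
- exact: continuous_addf.
have [r rP] := F0_gradient_bound i cL co Fu2.
have cchi : continuous chi.
  apply/quotient_continuous => a; have [dchi _] := chi1.
  exact: (differentiable_continuous (dchi a)).
have csep : continuous (torus_sep ^~ x0).
  apply: (continuous_compose _ torus_sep_continuous (f := fun x => (x, x0))).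
  by apply: continuous_pairing; [exact: continuous_identity|exact: continuous_constant].
(* [torus_sep x x0] makes [x0] the only maximum point and has zero gradient
   there. *)
pose a x := u1 i x - chi x - torus_sep x x0.
have ca : continuous a by apply: continuous_subf => //; exact: continuous_subf.
have [z [zmax zW]] := doubling ca (cu2 i).
have zx0 : z = x0.
  apply: torus_sep_eq0; apply/eqP; rewrite eq_le torus_sep_ge0 andbT.
  by have := zmax x0; have := touch z; rewrite /a torus_sepxx; lra.
rewrite couplingD.
(* The two subsolution inequalities give [E p <= 0] at a doubled maximum point
   [p]; continuity of [E] carries this over to [(x0, x0)]. *)
pose E (p : T * T) := coupling B u1 i p.1 + coupling B u2 i p.2
  - dotv (g i (p.1, xi)) (torus_grad chi p.1 + torus_grad (torus_sep ^~ x0) p.1)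
  - phi1 i (p.1, xi) - phi2 i (p.2, xi)
  - r * norm1 (g i (p.1, xi) - g i (p.2, xi)).
have cE : continuous E.
  have cf (Y : topologicalType) (f : T -> Y) : continuous f -> continuous (fun p : T * T => f p.1).
    by move=> cf; apply: (continuous_compose _ cf) => p; exact: cvg_fst.
  have cs (Y : topologicalType) (f : T -> Y) : continuous f -> continuous (fun p : T * T => f p.2).
    by move=> cf'; apply: (continuous_compose _ cf') => p; exact: cvg_snd.
  apply: continuous_subf; last first.
    apply: continuous_mulf; first exact: continuous_constant.
    apply: continuous_norm1B.
      by apply: (cf _ (fun x => g i (x, xi))); exact: continuous_slice.
    by apply: (cs _ (fun x => g i (x, xi))); exact: continuous_slice.
  apply: continuous_subf; last first.
    by apply: (cs _ (fun x => phi2 i (x, xi))); exact: continuous_slice.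
  apply: continuous_subf; last first.
    by apply: (cf _ (fun x => phi1 i (x, xi))); exact: continuous_slice.
  apply: continuous_subf; last first.
    apply: (cf _ (fun x => dotv (g i (x, xi)) (torus_grad chi x + torus_grad (torus_sep ^~ x0) x))).
    apply: continuous_dotv; first exact: continuous_slice.
    move=> x; apply: (@continuousD _ _ _ (torus_grad chi) (torus_grad (torus_sep ^~ x0))).
      exact: torus_grad_continuous.
    exact/torus_grad_continuous/torus_C1_sep.
  by apply: continuous_addf; [apply: cf|apply: cs]; exact: coupling_continuous.
have Ex0 : E (x0, x0) = coupling B u1 i x0 + coupling B u2 i x0
    - dotv (g i (x0, xi)) (torus_grad chi x0) - (phi1 i (x0, xi) + phi2 i (x0, xi)).
  by rewrite /E/= torus_grad_sepxx addr0 subrr norm1_0 mulr0 subr0 opprD addrA.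
rewrite -Ex0 leNgt; apply/negP => E0.
have [|N [[x y] [Exy xymax]]] := zW [set p | 0 < E p].
  rewrite zx0; apply: (cE (x0, x0) [set s | 0 < s]); apply: open_nbhs_nbhs.
  by split; [exact: open_gt|].
have C1 := torus_C1D chi1 (torus_C1_sep x0).
have C1N (w : T) : torus_C1 (fun x => N * torus_sep x w) by exact/torus_C1Z/torus_C1_sep.
pose q := torus_grad (fun y' => N * torus_sep y' x) y.
have touch2 y' : u2 i y' - N * torus_sep y' x <= u2 i y - N * torus_sep y x.
  have := xymax (x, y'); rewrite /doubled/= !(torus_sepC x); lra.
have touch1 x' : u1 i x' - (chi x' + torus_sep x' x0 + N * torus_sep x' y) <=
    u1 i x - (chi x + torus_sep x x0 + N * torus_sep x y).
  have := xymax (x', y); rewrite /doubled/= /a; lra.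
have grad1 : torus_grad (fun x' => chi x' + torus_sep x' x0 + N * torus_sep x' y) x =
    torus_grad chi x + torus_grad (torus_sep ^~ x0) x - q.
  rewrite (torus_gradD _ C1 (C1N y)) (torus_gradD _ chi1 (torus_C1_sep x0)).
  rewrite /q !torus_gradZ; [|exact: torus_C1_sep..].
  by rewrite (torus_grad_sepC x y) scalerN opprK.
have ineq1 := F0_touching xi Fu1 (torus_C1D C1 (C1N y)) touch1.
have ineq2 := F0_touching xi Fu2 (C1N x) touch2.
rewrite grad1 dotvDr dotvNr in ineq1; rewrite -/q in ineq2.
have := dotv_le (g i (x, xi) - g i (y, xi)) (rP _ _ (C1N x) touch2).
rewrite -/q dotvDl dotvNl ler_norml => /andP[h _].
move: Exy ineq1 ineq2 h; rewrite /E/=; lra.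
Qed.

End Subsolutions.

(** * Comparison and existence of the minimizing measure *)

Section Comparison.
Context {R : realType} {m n : nat} {Xi : pmetricType R}.
Local Notation T := (torus R n).
Local Open Scope quotient_scope.
Variables (g : 'I_m -> T * Xi -> 'rV[R]_n) (B : T -> 'M[R]_m)
  (L : 'I_m -> T * Xi -> R).
Hypotheses (m_gt0 : (0 < m)%N) (Xi_compact : compact [set: Xi])
  (g_cont : forall i, continuous (g i))
  (L_cont : forall i, continuous (L i))
  (B_cont : forall i j, continuous (fun x => B x i j))
  (H_coercive : coercive (hamiltonian g L))
  (B_monotone : forall x, monotone_mx (B x))
  (rho0 : forall i x, \sum_j B x i j = 0).
Implicit Types (u v : 'I_m -> T -> R).

(** Since the rows of [B] sum to zero, the maximum of [u - v] can be shifted to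
    zero before monotonicity is applied; no sign condition remains. *)
Lemma coupling_at_max u v k z :
  (forall i, u i z - v i z <= u k z - v k z) ->
  coupling B v k z <= coupling B u k z.
Proof.
move=> kmax; pose c := u k z - v k z.
pose w : 'cV[R]_m := \col_i (u i z - v i z - c).
have wk : w k 0 = 0 by rewrite mxE subrr.
have : 0 <= (B z *m w) k 0.
  apply: B_monotone; rewrite wk// => i; rewrite mxE subr_le0; exact: kmax.
rewrite mxE.
have -> : \sum_j B z k j * w j 0 = coupling B u k z - coupling B v k z.
  transitivity (\sum_j (B z k j * u j z - B z k j * v j z - c * B z k j)).
    by apply: eq_bigr => j _; rewrite mxE; ring.
  by rewrite !sumrB -mulr_sumr rho0 mulr0 subr0.
by rewrite subr_ge0.
Qed.

(** The component whose maximum of [u_i - v_i] is largest: only finitely many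
    maxima are compared. *)
Lemma exists_max_component u v : (forall i, continuous (u i)) ->
  (forall i, continuous (v i)) ->
  exists k, forall z, (forall y, u k y - v k y <= u k z - v k z) ->
    forall i, u i z - v i z <= u k z - v k z.
Proof.
move=> cu cv.
have [x xmax] := choice (fun i => compact_max (\pi_T 0) torus_compact
  (continuous_subf (cu i) (cv i))).
case: (@arg_maxP _ R _ (Ordinal m_gt0) xpredT (fun i => u i (x i) - v i (x i))) => //.
move=> k _ kmax; exists k => z zmax i.
apply: le_trans (xmax i z) _; apply: le_trans (kmax i isT) _; exact: zmax.
Qed.

(** A strict subsolution contradicts the supersolution [v0]: at a doubled
    maximum point of [u - v0] both have the same test gradient, and the coupling
    terms compare by monotonicity. *)
Lemma no_strict_subsolution phi u v0 (e : R) :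
  supersolution B (hamiltonian g L) v0 -> F0 g B (phi, u) -> 0 < e ->
  ~ forall i z, phi i z <= L i z - e.
Proof.
move=> [cv super] Fu e0 phiL; have [/= cphi [cu _]] := Fu.
have [k kmax] := exists_max_component cu cv.
have cNv : continuous (fun x => - v0 k x).
  by move=> x; apply: continuousN; exact: cv.
have [z [zmax zW]] := doubling (cu k) cNv.
have Bz : coupling B v0 k z <= coupling B u k z.
  exact/coupling_at_max/kmax.
have [r rP] := F0_gradient_bound Xi_compact g_cont B_cont k L_cont H_coercive Fu.
(* [F < 0] and [D < 0] say that replacing [y] with [x] in the Hamiltonian and in
   the coupling costs less than [e / 4] each, too little to fill the gap [e]. *)
pose F (q : (T * T) * Xi) := r * norm1 (g k (q.1.1, q.2) - g k (q.1.2, q.2))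
  + (L k (q.1.1, q.2) - L k (q.1.2, q.2)) - e / 4.
have cq1 : continuous (fun q : (T * T) * Xi => (q.1.1, q.2)).
  apply: continuous_pairing => q; last exact: cvg_snd.
  by apply: (continuous_compose (f := fst) (h := fst)) => [p|p]; exact: cvg_fst.
have cq2 : continuous (fun q : (T * T) * Xi => (q.1.2, q.2)).
  apply: continuous_pairing => q; last exact: cvg_snd.
  apply: (continuous_compose (f := fst) (h := snd)) => [p|p]; first exact: cvg_fst.
  exact: cvg_snd.
have cg1 := continuous_compose cq1 (@g_cont k).
have cg2 := continuous_compose cq2 (@g_cont k).
have cF : continuous F.
  apply: continuous_subf; last exact: continuous_constant.
  apply: continuous_addf.
    apply: continuous_mulf; first exact: continuous_constant.
    exact: continuous_norm1B.
  apply: continuous_subf.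
    exact: (continuous_compose cq1 (@L_cont k)).
  exact: (continuous_compose cq2 (@L_cont k)).
have nearF : \forall p \near (z, z), forall xi, F (p, xi) < 0.
  by apply: tube_lt => // xi; rewrite /F/= !subrr norm1_0 mulr0; lra.
pose D (p : T * T) := coupling B v0 k p.2 - coupling B u k p.1 - e / 4.
have cD : continuous D.
  apply: continuous_subf; last exact: continuous_constant.
  apply: continuous_subf.
    apply: (continuous_compose (f := snd)) => [p|]; first exact: cvg_snd.
    exact: coupling_continuous.
  apply: (continuous_compose (f := fst)) => [p|]; first exact: cvg_fst.
  exact: coupling_continuous.
have nearD : \forall p \near (z, z), D p < 0.
  apply: (cD (z, z) [set s | s < 0]); apply: open_nbhs_nbhs.
  by split; [exact: open_lt|rewrite /= /D/=; lra].
have [N [[x y] [[Fxy Dxy] xymax]]] := zW _ (filterI nearF nearD).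
have C1 (c : R) (w : T) : torus_C1 (fun x => c * torus_sep x w).
  exact/torus_C1Z/torus_C1_sep.
pose q := torus_grad (fun x' => N * torus_sep x' y) x.
have touch1 x' : u k x' - N * torus_sep x' y <= u k x - N * torus_sep x y.
  by have := xymax (x', y); rewrite /doubled/=; lra.
have touch2 y' : v0 k y - (- N) * torus_sep y x <= v0 k y' - (- N) * torus_sep y' x.
  by have := xymax (x, y'); rewrite /doubled/= !(torus_sepC x); lra.
have grad2 : torus_grad (fun y' => - N * torus_sep y' x) y = q.
  rewrite /q !torus_gradZ; [|exact: torus_C1_sep..].
  by rewrite (torus_grad_sepC x y) scalerN scaleNr opprK.
have := super k _ y (C1 (- N) x) touch2; rewrite grad2.
apply/negP; rewrite -ltNge -ltrBrDl sub0r.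
apply: le_lt_trans (_ : - coupling B u k x - 3 / 4 * e < _); last first.
  by move: Dxy; rewrite /D/=; lra.
apply: hamiltonian_le => xi.
have := F0_touching Xi_compact g_cont xi Fu (C1 N y) touch1.
have := dotv_le (g k (x, xi) - g k (y, xi)) (rP _ _ (C1 N y) touch1).
rewrite -/q dotvDl dotvNl ler_norml => /andP[_ h1] h2.
have := Fxy xi; rewrite /F/= => h3.
have := phiL k (x, xi); lra.
Qed.


Let X := (T * Xi)%type.

Lemma torus_compact_prod : compact [set: X].
Proof. by rewrite -setXTT; apply: compact_setX; [exact: torus_compact|]. Qed.

Lemma bounded_uncurry (phi : 'I_m -> X -> R) : (forall i, continuous (phi i)) ->
  bounded_on_type (fun z : 'I_m * X => phi z.1 z.2).
Proof.
move=> cphi.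
have [M MP] := choice (fun i => compact_continuous_bounded torus_compact_prod (cphi i)).
exists (\sum_i M i) => -[i x] /=; apply: le_trans (MP i x) _.
rewrite (bigD1 i)//= lerDl; apply: sumr_ge0 => j _.
exact: le_trans (normr_ge0 _) (MP j x).
Qed.

(** The functional separates the cone of all [phi - t * L] with [t > 0] from the
    negative functions, so [t * l L <= l phi]. For [phi = L] this holds with [t]
    above and below one and forces [l L = 0]. *)
Lemma optimal_functional v0 : solution B (hamiltonian g L) v0 ->
  exists l : ('I_m * X -> R) -> R, [/\ positive_functional l, l (fun=> 1) = 1,
    l (fun z => L z.1 z.2) = 0 &
    forall phi u, F0 g B (phi, u) -> 0 <= l (fun z => phi z.1 z.2)].
Proof.
move=> [v0_sub v0_super].
have FL : F0 g B (L, v0) by split.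
pose G : set ('I_m * X -> R) := [set h | exists phi u (t : R),
  [/\ F0 g B (phi, u), 0 < t & h = fun z => phi z.1 z.2 - t * L z.1 z.2]].
have [l [lpos l1 lG]] : exists l, [/\ positive_functional l, l (fun=> 1) = 1 &
    forall h, G h -> 0 <= l h].
  apply: cone_separation.
  - move=> _ [phi [u [t [[/= cphi _] _ ->]]]].
    apply: (@bounded_uncurry (fun i x => phi i x - t * L i x)) => i.
    apply: continuous_subf; first exact: cphi.
    by apply: continuous_mulf; [exact: continuous_constant|exact: L_cont].
  - exists L, v0, 1; split=> //.
    by apply/funext => -[i x]; rewrite mul1r subrr.
  - move=> _ _ [phi1 [u1 [t1 [F1 t10 ->]]]] [phi2 [u2 [t2 [F2 t20 ->]]]].
    exists (fun i z => phi1 i z + phi2 i z), (fun i x => u1 i x + u2 i x), (t1 + t2).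
    split; [|exact: addr_gt0|by apply/funext => -[i x] /=; ring].
    exact: (F0_add Xi_compact g_cont B_cont L_cont H_coercive F1 F2).
  - move=> s _ s0 [phi [u [t [F t0 ->]]]].
    exists (fun i z => s * phi i z), (fun i x => s * u i x), (s * t).
    split; [|exact: mulr_gt0|by apply/funext => -[i x] /=; ring].
    exact: (F0_scale Xi_compact g_cont s0 F).
  - move=> _ e [phi [u [t [F t0 ->]]]] e0 neg.
    have it0 : 0 < t^-1 by rewrite invr_gt0.
    apply: (no_strict_subsolution v0_super (F0_scale Xi_compact g_cont it0 F)
      (mulr_gt0 it0 e0)) => i x.
    have := neg (i, x); rewrite /= -(ler_pM2l it0).
    by rewrite mulrBr mulrA mulVf ?gt_eqF// mul1r mulrN; lra.
have [_ lZ _] := lpos.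
have bL := bounded_uncurry L_cont.
have lFt phi u t : F0 g B (phi, u) -> 0 < t ->
    t * l (fun z => L z.1 z.2) <= l (fun z => phi z.1 z.2).
  move=> F t0; have [/= cphi _] := F; have bphi := bounded_uncurry cphi.
  rewrite -subr_ge0 -lZ// -(functional_sub lpos)//; last exact: bounded_on_scale.
  by apply: lG; exists phi, u, t.
have lL : l (fun z => L z.1 z.2) = 0.
  have := lFt _ _ 2 FL (ltr0Sn _ 1).
  by have := lFt _ _ 2^-1 FL; rewrite invr_gt0 ltr0Sn => /(_ isT); lra.
exists l; split=> // phi u F.
by have := lFt _ _ 1 F ltr01; rewrite lL mulr0.
Qed.

End Comparison.

(* Joins the two structures of a product, pointed and topological, into the one
   over which [riesz_representation] is stated. *)
HB.instance Definition _ (X Y : ptopologicalType) := Pointed.on (X * Y)%type.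

(** A functional on functions of [(i, z)] is the sum of its restrictions to the
    slices of constant [i], and each of them is represented by a measure. *)
Lemma riesz_slices (R : realType) (m n : nat) (Xi : pmetricType R)
    (l : ('I_m * (torus R n * Xi) -> R) -> R) :
  compact [set: Xi] -> positive_functional l ->
  exists mu : measures R m n Xi, (\sum_i mu i setT = (l (fun=> 1))%:E)%E /\
    forall phi, (forall i, continuous (phi i)) ->
      pairing mu phi = l (fun z => phi z.1 z.2).
Proof.
move=> Xi_compact lpos; have [lD lZ l0] := lpos.
pose X := (torus R n * Xi)%type.
have X_compact : compact [set: X] by exact: torus_compact_prod.
pose slice (i : 'I_m) (f : X -> R) (z : 'I_m * X) : R :=
  if z.1 == i then f z.2 else 0.
have slice_bounded i f : bounded_on_type f -> bounded_on_type (slice i f).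
  move=> [M fM]; exists `|M| => -[j x]; rewrite /slice/=.
  case: eqP => _; last by rewrite normr0.
  exact: le_trans (fM x) (ler_norm _).
have slice_pos i : positive_functional (fun f : X -> R => l (slice i f)).
  split=> [f h bf bh|t f bf|f bf f0].
  - rewrite -lD; [|exact: slice_bounded..]; congr l; apply/funext => z.
    by rewrite /slice; case: eqP => _ //; rewrite addr0.
  - rewrite -lZ; [|exact: slice_bounded..]; congr l; apply/funext => z.
    by rewrite /slice; case: eqP => _ //; rewrite mulr0.
  - by apply: l0; [exact: slice_bounded|move=> z; rewrite /slice; case: eqP].
have sum_slices phi : (forall i, bounded_on_type (phi i)) ->
    \sum_i l (slice i (phi i)) = l (fun z => phi z.1 z.2).
  move=> bphi; have [_ <-] := functional_sum (index_enum 'I_m) lpos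
    (fun i => slice_bounded i _ (bphi i)).
  congr l; apply/funext => -[j x]; rewrite /slice/= (bigD1 j)//= eqxx.
  by rewrite big1 ?addr0// => i /negbTE; rewrite eq_sym => ->.
have [A regA] := @regular_family_torus R n.
have [A' regA'] := regular_family_compact_metric Xi_compact.
have [C regC] := regular_family_prod regA regA'.
have [mu muP] := choice (fun i => @riesz_representation R (torus R n * Xi)%type
  _ _ X_compact regC (slice_pos i)).
exists mu; split.
  under eq_bigr do rewrite (muP _).1.
  rewrite sumEFin (sum_slices (fun _ _ => 1))//.
  by move=> _; exact: bounded_on_cst.
move=> phi cphi; rewrite -sum_slices.
  by apply: eq_bigr => i _; have [_ ->] := muP i.
by move=> i; exact: compact_continuous_bounded.
Qed.

Unset Implicit Arguments.

Theorem theorem12 (R : realType) (m n : nat) (Xi : pmetricType R)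
    (g : 'I_m -> torus R n * Xi -> 'rV[R]_n)
    (L : 'I_m -> torus R n * Xi -> R)
    (B : torus R n -> 'M[R]_m)
    (v0 : 'I_m -> torus R n -> R)
    (m_gt0 : (0 < m)%N) (n_gt0 : (0 < n)%N)
    (Xi_compact : compact [set: Xi])
    (g_cont : forall i, continuous (g i))
    (L_cont : forall i, continuous (L i))
    (B_cont : forall i j, continuous (fun x => B x i j))
    (H_coercive : coercive (hamiltonian g L))
    (B_monotone : forall x, monotone_mx (B x))
    (v0_lip : forall i, torus_lipschitz (v0 i))
    (v0_sol : solution B (hamiltonian g L) v0)
    (rho0 : forall i x, \sum_j B x i j = 0) :
  exists mu0 : measures R m n Xi,
    [/\ P0 g B mu0,
        pairing mu0 L = 0 &
        forall mu : measures R m n Xi, P0 g B mu -> pairing mu0 L <= pairing mu L].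

Proof.
have [l [lpos l1 lL lF]] := optimal_functional m_gt0 Xi_compact g_cont L_cont
  B_cont H_coercive B_monotone rho0 v0_sol.
have [mu [mu1 muE]] := riesz_slices Xi_compact lpos.
have mu_L : pairing mu L = 0 by rewrite muE.
exists mu; split=> //.
  split; first by rewrite /prob_measures/= mu1 l1.
  by move=> phi u F; have [/= cphi _] := F; rewrite muE//; exact: lF F.
move=> nu [_ nuF]; rewrite mu_L; apply: (nuF L v0).
by have [v0_sub _] := v0_sol; split.
Qed.
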